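(* The set of all strongly permutative semigroup varieties is definable.
   Context: $\mathbf{SEM}$ denotes the lattice of all semigroup varieties, ordered by inclusion, with join $\vee$ and meet $\wedge$. A subset $A$ of a lattice $\langle L;\vee,\wedge\rangle$ is called definable in $L$ if there is a first-order formula $\Phi(x)$ with one free variable $x$ (and no parameters) in the language of the lattice operations $\vee$ and $\wedge$ such that, for every $a\in L$, the sentence $\Phi(a)$ is true in $L$ if and only if $a\in A$. A set of semigroup varieties is called definable if it is definable in $\mathbf{SEM}$. A semigroup variety is called strongly permutative if it satisfies an identity of the form $x_1x_2\cdots x_n=x_{1\alpha}x_{2\alpha}\cdots x_{n\alpha}$, where $\alpha$ is a non-trivial permutation of the set $\{1,2,\dots,n\}$ with $1\alpha\ne1$ and $n\alpha\ne n$ (here $i\alpha$ denotes the image of $i$ under $\alpha$). *)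

(* Defs.v *)
From HB Require Import structures.
From mathcomp Require Import all_boot all_order all_fingroup.
From mathcomp Require Import boolp classical_sets.
Set Implicit Arguments.
Unset Strict Implicit.
Unset Printing Implicit Defensive.
Import Order.TTheory.

Local Open Scope classical_set_scope.

(* First-order language with equality and two binary operation symbols.
   Variables are named by natural numbers; there are no constants, hence no
   parameters. *)
Inductive lterm : Type :=
  | LVar of nat
  | LJoin of lterm & lterm
  | LMeet of lterm & lterm.

Inductive lformula : Type :=
  | LEq of lterm & lterm
  | LNot of lformula
  | LAnd of lformula & lformula
  | LOr of lformula & lformula
  | LImplies of lformula & lformula
  | LForall of nat & lformula
  | LExists of nat & lformula.

Fixpoint lterm_vars (t : lterm) : seq nat :=
  match t with
  | LVar x => [:: x]
  | LJoin t1 t2 | LMeet t1 t2 => lterm_vars t1 ++ lterm_vars t2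
  end.

Fixpoint free_vars (phi : lformula) : seq nat :=
  match phi with
  | LEq t1 t2 => lterm_vars t1 ++ lterm_vars t2
  | LNot f => free_vars f
  | LAnd f1 f2 | LOr f1 f2 | LImplies f1 f2 => free_vars f1 ++ free_vars f2
  | LForall x f | LExists x f => [seq y <- free_vars f | y != x]
  end.

Section Definability.
Context {d : Order.disp_t} {L : latticeType d}.
Implicit Type e : nat -> L.

Fixpoint lterm_eval e (t : lterm) : L :=
  match t with
  | LVar x => e x
  | LJoin t1 t2 => Order.join (lterm_eval e t1) (lterm_eval e t2)
  | LMeet t1 t2 => Order.meet (lterm_eval e t1) (lterm_eval e t2)
  end.

Fixpoint lholds e (phi : lformula) : Prop :=
  match phi with
  | LEq t1 t2 => lterm_eval e t1 = lterm_eval e t2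
  | LNot f => ~ lholds e f
  | LAnd f1 f2 => lholds e f1 /\ lholds e f2
  | LOr f1 f2 => lholds e f1 \/ lholds e f2
  | LImplies f1 f2 => lholds e f1 -> lholds e f2
  | LForall x f => forall a : L, lholds [eta e with x |-> a] f
  | LExists x f => exists a : L, lholds [eta e with x |-> a] f
  end.

Definition definable (A : set L) : Prop :=
  exists (phi : lformula) (x : nat),
    free_vars phi =i [:: x] /\ forall e, lholds e phi <-> A (e x).

End Definability.

(* The carrier is a bare Type rather than a choiceType (as it would be for
   semigroupType): the collection of all varieties lives one universe above the
   semigroups, and must itself be a choiceType in order to be a latticeType. *)
Record semigroup : Type := Semigroup {
  sg_sort :> Type;
  sg_mul : SemiGroup.law sg_sort;
  sg_nonempty : inhabited sg_sort
}.

(* (x, s) is the nonempty word x :: s over the alphabet of the letters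
   x_0, x_1, ... *)
Definition word : Type := (nat * seq nat)%type.
Definition identity : Type := (word * word)%type.

Definition word_eval (S : semigroup) (f : nat -> S) (w : word) : S :=
  foldl (sg_mul S) (f w.1) (map f w.2).

Definition satisfies (S : semigroup) (i : identity) : Prop :=
  forall f : nat -> S, word_eval f i.1 = word_eval f i.2.

Definition models (E : set identity) : set semigroup :=
  [set S | forall i, E i -> satisfies S i].

Record variety : Type := Variety {
  variety_class :> set semigroup;
  varietyP : exists E : set identity, variety_class = models E
}.

Definition identities (C : set semigroup) : set identity :=
  [set i | forall S, C S -> satisfies S i].

Lemma variety_inj (V W : variety) :
  (V : set semigroup) = (W : set semigroup) -> V = W.
Proof.
case: V W => [V pV] [W pW] /= eVW; case: _ / eVW pW => pW.
by congr Variety; exact: Prop_irrelevance.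
Qed.

Lemma models_identities (V : variety) : models (identities V) = V.
Proof.
apply/seteqP; split=> [S|S VS i]; last exact.
case: (varietyP V) => E EV; rewrite EV => SV i Ei.
by apply: SV => T; apply.
Qed.

Definition variety_le (V W : variety) : bool := `[< V `<=` W >].

Fact variety_meet_subproof (V W : variety) :
  exists E, V `&` W = models E.
Proof.
case: (varietyP V) (varietyP W) => [E ->] [F ->]; exists (E `|` F).
apply/seteqP; split=> [S [SE SF] i [/SE|/SF] //|S SEF].
by split=> i Ei; apply: SEF; [left|right].
Qed.

Definition variety_meet (V W : variety) : variety :=
  Variety (variety_meet_subproof V W).

(* The variety generated by the union of the two classes. *)
Definition variety_join (V W : variety) : variety :=
  @Variety (models (identities (V `|` W))) (ex_intro _ _ erefl).

Fact variety_le_refl : reflexive variety_le.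
Proof. by move=> V; exact/asboolP. Qed.

Fact variety_le_anti : antisymmetric variety_le.
Proof.
by move=> V W /andP[/asboolP VW /asboolP WV]; apply/variety_inj/seteqP.
Qed.

Fact variety_le_trans : transitive variety_le.
Proof.
by move=> W V U /asboolP VW /asboolP WU; apply/asboolP => S /VW /WU.
Qed.

Fact variety_meetP (U V W : variety) :
  variety_le U (variety_meet V W) = variety_le U V && variety_le U W.
Proof.
apply/asboolP/andP => [UVW|[/asboolP UV /asboolP UW] S US].
  by split; apply/asboolP => S /UVW [].
by split; [exact: UV|exact: UW].
Qed.

Fact variety_joinP (V W U : variety) :
  variety_le (variety_join V W) U = variety_le V U && variety_le W U.
Proof.
apply/asboolP/andP => [VWU|[/asboolP VU /asboolP WU] S SVW].
  by split; apply/asboolP => S HS; apply: VWU => i; apply; [left|right].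
rewrite -models_identities => i iU; apply: SVW => T [/VU|/WU]; exact: iU.
Qed.

Fact variety_display : Order.disp_t. Proof. exact: Order.Disp tt tt. Qed.

HB.instance Definition _ := gen_eqMixin variety.
HB.instance Definition _ := gen_choiceMixin variety.
HB.instance Definition _ := Order.Le_isPOrder.Build variety_display variety
  variety_le_refl variety_le_anti variety_le_trans.
HB.instance Definition _ :=
  Order.POrder_MeetJoin_isLattice.Build variety_display variety
    variety_meetP variety_joinP.

Notation SEM := (variety : latticeType variety_display).

(* The word x_{s 0} x_{s 1} ... x_{s n}. *)
Definition perm_word (n : nat) (s : 'S_n.+1) : word :=
  (nat_of_ord (s ord0), [seq nat_of_ord (s (lift ord0 i)) | i <- enum 'I_n]).

Definition strongly_permutative (V : variety) : Prop :=
  exists (n : nat) (s : 'S_n.+1),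
    [/\ s != 1%g, s ord0 != ord0, s ord_max != ord_max &
        identities V (perm_word (1%g : 'S_n.+1), perm_word s)].

(* Main.v *)
From HB Require Import structures.
Require Import Defs.
From mathcomp Require Import all_boot all_order all_fingroup.
From mathcomp Require Import boolp classical_sets.
From mathcomp Require Import zify.
From Stdlib Require Import Setoid Morphisms.
Set Implicit Arguments.
Unset Strict Implicit.
Unset Printing Implicit Defensive.
Import Order.TTheory.

(** A variety [V] is strongly permutative if and only if [V <= COM \/ NIL n] for
    some [n], where [COM] is the variety of all commutative semigroups and
    [NIL n] is defined by [x1 ... xn = 0]. An identity holds in the join when its
    sides have the same letters with the same multiplicities and, if they differ,
    have length at least [n]. These hold in a strongly permutative variety for
    large [n]: the given identity, whose sides start with different letters,
    makes a letter commute with a block at the start of every long word, which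
    allows any two first letters to be exchanged ([letter_jumps_block],
    [swap_first_letters]); dually any two last letters, hence any two adjacent
    letters of a long word ([long_balanced]).

    It remains to define [COM] and a set of nilpotent varieties that contains
    [NIL n] for all large [n]. All is phrased in terms of equational theories:
    by [eqn_var_of] they are exactly the fully invariant congruences on words,
    and inclusion of varieties reverses inclusion of theories.

    The atoms of the lattice are the left zero, right zero and null semigroups,
    the semilattices, and the groups of prime order ([atomP]): each atom that a
    variety omits yields an identity with a different kind of imbalance, and
    together these identities force triviality. The same computation, with all
    atoms but one omitted, shows that left zero and right zero semigroups are
    not properly contained in a variety with no other atom, whereas groups of
    order [p] are (take the abelian groups of exponent [p^2]). So the atoms with
    such an extension are commutative and include all the groups of prime
    order. Letter counts that agree modulo every prime are equal, so these
    groups generate [COM], which is the join of the atoms with an extension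
    ([lub_of_extensibleP]).

    Null semigroups [ZM] are now recognised among the atoms: semilattices, left
    zero and right zero semigroups are not the sole atom of a larger commutative
    variety, and groups of order [p] fail the condition that [Y <= X \/ z]
    implies [z <= Y] or [Y <= X] ([separable_ZM], [not_separable_AB]).

    A variety [N] with [ZM] as sole atom is nil. If it is not nilpotent, then it
    contains the variety [CLIN] given by [xy = yx] and [x^2 = 0]: an identity
    that fails there makes some [x1 ... xn] equal to a longer word, and iterating
    this produces arbitrarily high powers ([linear_lengthened]). Now [CLIN] has no
    lower cover, its proper subvarieties being nilpotent, whereas [NIL n] has
    finitely many subvarieties, so each nontrivial one has a lower cover
    ([above_CLIN_not_lower_covered], [lower_covered_NIL]). Requiring lower covers below
    [N] therefore singles out nilpotent varieties, among them all the [NIL n]. *)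

(** * Identities as fully invariant congruences *)

Definition subst (f : nat -> seq nat) (s : seq nat) : seq nat :=
  flatten (map f s).

(** Fully invariant congruences of the free monoid in which the empty word is
    alone in its class; a substitution may not erase letters, since it stands
    for an endomorphism of the free semigroup. *)
Record fic (E : seq nat -> seq nat -> Prop) : Prop := Fic {
  fic_refl : forall s, E s s;
  fic_sym : forall s t, E s t -> E t s;
  fic_trans : forall t s u, E s t -> E t u -> E s u;
  fic_nil : forall s, E [::] s -> s = [::];
  fic_cat : forall s t s' t', E s t -> E s' t' -> E (s ++ s') (t ++ t');
  fic_subst : forall f s t,
    (forall x, f x != [::]) -> E s t -> E (subst f s) (subst f t)
}.

Lemma subst_cat f s t : subst f (s ++ t) = subst f s ++ subst f t.
Proof. by rewrite /subst map_cat flatten_cat. Qed.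

Lemma subst_cons f x s : subst f (x :: s) = f x ++ subst f s.
Proof. by []. Qed.

Lemma subst_letters (g : nat -> nat) s : subst (fun x => [:: g x]) s = map g s.
Proof. exact: flatten_map1. Qed.

Lemma subst_eq_nil f s :
  (forall x, f x != [::]) -> (subst f s == [::]) = (s == [::]).
Proof. by move=> f0; case: s => //= x s; rewrite subst_cons; case: (f x) (f0 x). Qed.

Lemma eq_subst_in f g s : {in s, f =1 g} -> subst f s = subst g s.
Proof. by move=> fg; rewrite /subst; congr flatten; apply/eq_in_map. Qed.

Lemma cat_eq_nil (T : eqType) (s t : seq T) :
  (s ++ t == [::]) = (s == [::]) && (t == [::]).
Proof. by case: s. Qed.

Section EvalWords.
Variable S : semigroup.
Implicit Types (f : nat -> S) (s t : seq nat).

(** The value of the word [s] under [f]; the empty word, which has no value,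
    receives that of the letter 0. *)
Definition eval f s : S := word_eval f (head 0 s, behead s).

Lemma eval_cat f s t : s != [::] -> t != [::] ->
  eval f (s ++ t) = sg_mul S (eval f s) (eval f t).
Proof.
case: s t => // x s [] // y t _ _.
rewrite /eval /word_eval /= map_cat foldl_cat /=.
set a := foldl _ (f x) _; elim: (map f t) (f y) => //= c r IH b.
by rewrite -IH SemiGroup.opA.
Qed.

Lemma eval_subst f g s : (forall x, g x != [::]) -> s != [::] ->
  eval f (subst g s) = eval (fun x => eval f (g x)) s.
Proof.
move=> g0; elim: s => // x [_ _|y s IH _]; first by rewrite /subst /= cats0.
rewrite subst_cons eval_cat ?subst_eq_nil // IH //.
by rewrite -[x :: y :: s]/([:: x] ++ y :: s) eval_cat.
Qed.

End EvalWords.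

(** Identities are extended to possibly empty words, so that they form a
    congruence of the free monoid: the empty word is equal to itself only. *)
Definition eqn (V : variety) (s t : seq nat) : Prop :=
  (s == [::]) = (t == [::]) /\
  forall S : semigroup, (V : set semigroup) S ->
    forall f : nat -> S, eval f s = eval f t.

Lemma eqn_fic V : fic (eqn V).
Proof.
split=> [s|s t [e H]|t s u [e H] [e' H']|s [e _]|s t s' t' [e H] [e' H']|f s t f0 [e H]].
- by [].
- by split=> [//|S VS f]; rewrite H.
- by split=> [|S VS f]; [rewrite e e'|rewrite H ?H'].
- by move/esym: e => /eqP.
- split=> [|S VS f]; first by rewrite !cat_eq_nil e e'.
  have [/eqP s0|s0] := boolP (s == [::]).
    by move: e; rewrite s0 eqxx => /esym/eqP ->; apply: H'.
  have t0 : t != [::] by rewrite -e.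
  have [/eqP s0'|s0'] := boolP (s' == [::]).
    by move: e'; rewrite s0' eqxx => /esym/eqP ->; rewrite !cats0; apply: H.
  have t0' : t' != [::] by rewrite -e'.
  by rewrite !eval_cat // H // H'.
- split=> [|S VS g]; first by rewrite !subst_eq_nil.
  have [/eqP s0|s0] := boolP (s == [::]).
    by move: e; rewrite s0 eqxx => /esym/eqP ->.
  by rewrite !eval_subst -?e // H.
Qed.

Lemma eqn_identities V x s y t :
  eqn V (x :: s) (y :: t) <-> identities V ((x, s), (y, t)).
Proof. by split=> [[_ H]|H]; last split. Qed.

Lemma variety_leP (V W : variety) :
  reflect (forall s t, eqn W s t -> eqn V s t) (V <= W)%O.
Proof.
apply: (iffP (asboolP _)) => [VW s t [e H]|EVW].
  by split=> // S /VW; apply: H.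
rewrite -[W in (_ `<=` W)%classic]models_identities => S VS [[x s] [y t]].
by move=> /eqn_identities/EVW/eqn_identities; apply.
Qed.

Lemma eqn_join (V W : variety) s t :
  eqn (V `|` W)%O s t <-> eqn V s t /\ eqn W s t.
Proof.
split=> [H|[[e HV] [_ HW]]].
  split; last by move: s t H; apply/variety_leP; exact: leUr.
  by move: s t H; apply/variety_leP; exact: leUl.
case: s e HV HW => [|x s].
  by move=> /esym; rewrite eqxx => /eqP -> _ _; exact: (fic_refl (eqn_fic _)).
case: t => // y t _ HV HW; apply/eqn_identities => S; apply.
by move=> T [/HV|/HW].
Qed.

Section FreeSemigroup.
Variables (E : seq nat -> seq nat -> Prop) (ficE : fic E).

Definition canon s : seq nat := choose (fun t => `[<E s t>]) s.

Lemma canonP s : E s (canon s).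
Proof. apply/asboolP; apply: (@chooseP _ (fun t => `[<E s t>])); apply/asboolP/(fic_refl ficE). Qed.

Lemma canon_eq s t : E s t -> canon s = canon t.
Proof.
move=> st; rewrite /canon.
have eqE : (fun u => `[<E s u>]) =1 (fun u => `[<E t u>]).
  move=> u; apply/asboolP/asboolP; first exact: (fic_trans ficE (fic_sym ficE st)).
  exact: (fic_trans ficE st).
rewrite (eq_choose eqE); apply: (@choose_id _ (fun u => `[<E t u>])).
  exact/asboolP/(fic_sym ficE).
exact/asboolP/(fic_refl ficE).
Qed.

(** The quotient of the free semigroup by [E], carried by the chosen
    representatives so that equality in it is equality of words. *)
Definition free_quo : Type :=
  {s : seq nat | (s != [::]) && (canon s == s)}.

Lemma canon_subproof s : s != [::] -> (canon s != [::]) && (canon (canon s) == canon s).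
Proof.
move=> s0; apply/andP; split; last by rewrite -(canon_eq (canonP s)).
apply/eqP => c0; move: (canonP s); rewrite c0 => /(fic_sym ficE)/(fic_nil ficE).
exact/eqP.
Qed.

Lemma free_quo_cat (a b : free_quo) : val a ++ val b != [::].
Proof. by case: a => s /= /andP[s0 _]; rewrite cat_eq_nil negb_and s0. Qed.

Definition free_mul (a b : free_quo) : free_quo :=
  exist _ (canon (val a ++ val b)) (canon_subproof (free_quo_cat a b)).

Lemma free_mulA : associative free_mul.
Proof.
move=> a b c; apply: val_inj => /=; apply: canon_eq.
apply: (fic_trans ficE (t := val a ++ val b ++ val c)).
  apply: (fic_cat ficE); first exact: (fic_refl ficE).
  exact/(fic_sym ficE)/canonP.
rewrite catA; apply: (fic_cat ficE); first exact: canonP.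
exact: (fic_refl ficE).
Qed.

HB.instance Definition _ := SemiGroup.isLaw.Build free_quo free_mul free_mulA.

Definition free_letter (x : nat) : free_quo :=
  exist _ (canon [:: x]) (canon_subproof (isT : [:: x] != [::])).

Definition free_semigroup : semigroup :=
  @Defs.Semigroup _ (free_mul : SemiGroup.law free_quo) (inhabits (free_letter 0)).

Lemma free_val (f : nat -> free_semigroup) s : s != [::] ->
  val (eval f s) = canon (subst (fun x => val (f x)) s).
Proof.
elim: s => // x [_ _|y s IH _].
  rewrite /subst /= cats0 -[eval f _]/(f x).
  by case: (f x : free_quo) => r /= /andP[_ /eqP].
rewrite -[x :: y :: s]/([:: x] ++ y :: s) eval_cat //.
change (canon (val (f x) ++ val (eval f (y :: s))) =
  canon (subst (fun x => val (f x)) ([:: x] ++ y :: s))).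
rewrite IH // subst_cat /subst /= cats0.
apply: canon_eq; apply: (fic_cat ficE); first exact: (fic_refl ficE).
exact/(fic_sym ficE)/canonP.
Qed.

Lemma val_neq_nil (a : free_quo) : val a != [::].
Proof. by case: a => s /= /andP[]. Qed.

Lemma eval_letters s : s != [::] ->
  E s (val (eval (free_letter : nat -> free_semigroup) s)).
Proof.
move=> s0; rewrite free_val //; apply: (fic_trans ficE _ (canonP _)).
elim: s {s0} => [|x s IH]; first exact: (fic_refl ficE).
rewrite subst_cons -[x :: s]/([:: x] ++ s); apply: (fic_cat ficE) IH.
exact: canonP.
Qed.

(** A valuation in the quotient is a substitution up to [E], so full invariance
    makes it a model of [E], and the valuation of letters by their own classes
    detects everything outside [E]. *)
Lemma free_models s t : s != [::] -> t != [::] ->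
  (forall f : nat -> free_semigroup, eval f s = eval f t) <-> E s t.
Proof.
move=> s0 t0; split=> [H|st f].
  apply: (fic_trans ficE (eval_letters s0)); rewrite H.
  exact/(fic_sym ficE)/eval_letters.
apply: val_inj; rewrite !free_val //; apply/canon_eq/(fic_subst ficE) => // x.
exact: val_neq_nil.
Qed.

End FreeSemigroup.

Definition var_of (E : seq nat -> seq nat -> Prop) : variety :=
  @Variety (models [set i : identity | E (i.1.1 :: i.1.2) (i.2.1 :: i.2.2)]%classic)
    (ex_intro _ _ erefl).

Lemma eqn_var_of E : fic E -> forall s t, eqn (var_of E) s t <-> E s t.
Proof.
move=> ficE s t; split=> [[e H]|st].
  case: s t e H => [|x s] [|y t] // _ H; first exact: (fic_refl ficE).
  apply/(free_models ficE) => //; apply: H => -[[x' s'] [y' t']] /= E'.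
  by have /(free_models ficE) := E'; apply.
case: s t st => [t /(fic_nil ficE) ->|x s]; first exact: (fic_refl (eqn_fic _)).
case=> [/(fic_sym ficE)/(fic_nil ficE)//|y t st].
by split=> // S VS; apply: (VS ((x, s), (y, t))).
Qed.

(** * The varieties that occur in the formula *)

Definition same_head (s t : seq nat) : Prop := ohead s = ohead t.
Definition same_last (s t : seq nat) : Prop := ohead (rev s) = ohead (rev t).
Definition same_content (s t : seq nat) : Prop := s =i t.
Definition same_count_mod (d : nat) (s t : seq nat) : Prop :=
  (s == [::]) = (t == [::]) /\
  forall x, count_mem x s = count_mem x t %[mod d].

(** The Rees construction relative to [E]: the words of [I] become zero. *)
Definition collapse (E : seq nat -> seq nat -> Prop) (I : pred (seq nat)) s t :=
  E s t \/ I s /\ I t.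

(** The theory of the dual variety. *)
Definition reversed (E : seq nat -> seq nat -> Prop) s t := E (rev s) (rev t).

Lemma rev_subst f s : rev (subst f s) = subst (rev \o f) (rev s).
Proof.
by elim: s => // x s IH; rewrite subst_cons rev_cat IH rev_cons -cats1 subst_cat
  [subst _ [:: x]]/subst /= cats0.
Qed.

Lemma fic_reversed E : fic E -> fic (reversed E).
Proof.
move=> ficE; split=> [s|s t|t s u|s|s t s' t'|f s t f0]; rewrite /reversed.
- exact: (fic_refl ficE).
- exact: (fic_sym ficE).
- exact: (fic_trans ficE).
- by move=> /(fic_nil ficE)/(congr1 rev); rewrite revK.
- by rewrite !rev_cat => st st'; apply: (fic_cat ficE).
- rewrite !rev_subst; apply: (fic_subst ficE) => x /=.
  by rewrite -size_eq0 size_rev size_eq0.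
Qed.

Lemma reversedK E : reversed (reversed E) = E.
Proof. by apply/funext => s; apply/funext => t; rewrite /reversed !revK. Qed.

Lemma fic_same_head : fic same_head.
Proof.
rewrite /same_head; split=> [//|s t ->//|t s u -> -> //|[] //|s t s' t'|f s t f0].
- by case: s t => [|x s] [|y t] //= [->].
- case: s t => [|x s] [|y t] //= [->]; rewrite !subst_cons.
  by case: (f y) (f0 y).
Qed.

Lemma fic_same_last : fic same_last.
Proof. exact: (fic_reversed fic_same_head). Qed.

Lemma mem_subst f s y : (y \in subst f s) = has (fun x => y \in f x) s.
Proof. by elim: s => // x s IH; rewrite subst_cons mem_cat IH. Qed.

Lemma fic_same_content : fic same_content.
Proof.
split=> [//|s t st x|t s u st tu x|s|s t s' t' st st' x|f s t f0 st y].
- by rewrite st.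
- by rewrite st tu.
- by case: s => // x s /(_ x); rewrite mem_head.
- by rewrite !mem_cat st st'.
- by rewrite !mem_subst; apply: eq_has_r.
Qed.

Lemma sum_count (g : nat -> nat) s r : uniq r -> {subset s <= r} ->
  \sum_(x <- s) g x = \sum_(x <- r) count_mem x s * g x.
Proof.
move=> Ur; elim: s => [|y s IH] sr; first by rewrite big_nil big1.
rewrite big_cons IH => [|x xs]; last by apply: sr; rewrite inE xs orbT.
under [RHS]eq_bigr => x _ do rewrite /= mulnDl.
rewrite big_split /=; congr (_ + _).
rewrite (bigD1_seq y) ?sr ?mem_head //= eqxx mul1n big1 ?addn0 // => x.
by rewrite eq_sym => /negbTE ->.
Qed.

Lemma sum_count_mod d (g : nat -> nat) s t :
  (forall x, count_mem x s = count_mem x t %[mod d]) ->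
  \sum_(x <- s) g x = \sum_(x <- t) g x %[mod d].
Proof.
move=> H; rewrite !(@sum_count g _ (undup (s ++ t))) ?undup_uniq //; first last.
- by move=> x xs; rewrite mem_undup mem_cat xs.
- by move=> x xs; rewrite mem_undup mem_cat xs orbT.
elim: (undup _) => [|x r IH]; first by rewrite !big_nil.
by rewrite !big_cons -modnDm -modnMml H IH modnMml modnDm.
Qed.

Lemma count_subst f s y :
  count_mem y (subst f s) = \sum_(x <- s) count_mem y (f x).
Proof.
by elim: s => [|x s IH]; rewrite ?big_nil // subst_cons count_cat IH big_cons.
Qed.

Lemma fic_same_count_mod d : fic (same_count_mod d).
Proof.
split=> [//|s t [e H]|t s u [e H] [e' H']|s [/esym/eqP //]|s t s' t' [e H] [e' H']
        |f s t f0 [e H]].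
- by split.
- by split=> [|x]; rewrite ?e // H.
- split=> [|x]; first by rewrite !cat_eq_nil e e'.
  by rewrite !count_cat -modnDm H H' modnDm.
- split=> [|x]; first by rewrite !subst_eq_nil.
  by rewrite !count_subst; apply: sum_count_mod.
Qed.

Lemma fic_perm : fic (perm_eq : seq nat -> seq nat -> Prop).
Proof.
split=> [s|s t|t s u|s|s t s' t'|f s t f0].
- exact: perm_refl.
- by rewrite perm_sym.
- exact: perm_trans.
- by rewrite perm_sym => /perm_nilP.
- exact: perm_cat.
- by move=> st; apply/perm_flatten/perm_map.
Qed.

Lemma fic_eq : fic (@eq (seq nat)).
Proof. by split=> // [t s u -> ->|s t s' t' -> ->|f s t _ ->]. Qed.

Record fi_ideal (I : pred (seq nat)) : Prop := FiIdeal {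
  ideal_nil : ~~ I [::];
  ideal_catl : forall s t, I s -> I (s ++ t);
  ideal_catr : forall s t, I t -> I (s ++ t);
  ideal_subst : forall f s, (forall x, f x != [::]) -> I s -> I (subst f s)
}.

Lemma fic_collapse E I : fic E -> fi_ideal I ->
  (forall s t, E s t -> I s -> I t) -> fic (collapse E I).
Proof.
move=> ficE [I0 Il Ir If] EI; have Es := fic_sym ficE.
split=> [s|s t [st|[]]|t s u [st|[Is It]] [tu|[It' Iu]]|s [|[Is _]]
        |s t s' t' [st|[Is It]] [st'|[Is' It']]|f s t f0 [st|[Is It]]].
- by left; apply: (fic_refl ficE).
- by left; apply: Es.
- by right.
- by left; apply: (fic_trans ficE st).
- by right; split=> //; apply: EI It'; apply: Es.
- by right; split=> //; apply: EI It.
- by right.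
- exact: (fic_nil ficE).
- by rewrite Is in I0.
- by left; apply: (fic_cat ficE).
- by right; split; apply: Ir.
- by right; split; apply: Il.
- by right; split; apply: Il.
- by left; apply: (fic_subst ficE).
- by right; split; apply: If.
Qed.

Lemma leq_size_subst f s : (forall x, f x != [::]) -> size s <= size (subst f s).
Proof.
move=> f0; elim: s => // x s IH; rewrite subst_cons size_cat /=.
by case: (f x) (f0 x) => //= y r _; rewrite addSn ltnS (leq_trans IH) ?leq_addl.
Qed.

Lemma subst_uniq f s : (forall x, f x != [::]) -> uniq (subst f s) -> uniq s.
Proof.
move=> f0; elim: s => // x s IH; rewrite subst_cons cat_uniq /=.
case/and3P => _ /hasPn xs /IH ->; rewrite andbT; apply/negP => x_s.
case fx : (f x) (f0 x) => [//|y r] _.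
have := xs y; rewrite /= fx inE eqxx mem_subst; case: hasP => [_ /(_ isT)//|[]].
by exists x => //; rewrite fx inE eqxx.
Qed.

(** A linear word is a most general word of its length; the surplus of [w] goes
    to the last letter. *)
Lemma linear_subst (s w : seq nat) : s != [::] -> uniq s -> size s <= size w ->
  exists2 g, forall x, g x != [::] & subst g s = w.
Proof.
elim: s w => // x [_ [//|c w] _ _ _|y s IH [//|c w] _ /andP[xs Us] sw].
  by exists (fun=> c :: w); rewrite // subst_cons cats0.
have [g g0 gw] := IH w isT Us sw.
exists (fun z => if z == x then [:: c] else g z) => [z|]; first by case: ifP.
rewrite subst_cons eqxx -gw; congr (_ ++ _); apply: eq_subst_in => z zs.
by case: eqP => // e; rewrite -e zs in xs.
Qed.

Definition long n (s : seq nat) : bool := n <= size s.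
Definition nonlinear (s : seq nat) : bool := ~~ uniq s.
Definition nonlinear_or_long n s : bool := nonlinear s || long n s.

Lemma ideal_long n : 0 < n -> fi_ideal (long n).
Proof.
move=> n0; split=> [|s t|s t|f s f0]; rewrite /long.
- by rewrite -ltnNge.
- by rewrite size_cat => /leq_trans; apply; apply: leq_addr.
- by rewrite size_cat => /leq_trans; apply; apply: leq_addl.
- by move/leq_trans; apply; apply: leq_size_subst.
Qed.

Lemma ideal_nonlinear : fi_ideal nonlinear.
Proof.
split=> [//|s t|s t|f s f0]; rewrite /nonlinear.
- by apply: contra; rewrite cat_uniq => /and3P[].
- by apply: contra; rewrite cat_uniq => /and3P[].
- by apply: contra; apply: subst_uniq.
Qed.

Lemma ideal_nonlinear_or_long n : 0 < n -> fi_ideal (nonlinear_or_long n).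
Proof.
move=> /ideal_long[l0 ll lr lf]; have [u0 ul ur uf] := ideal_nonlinear.
split=> [|s t|s t|f s f0]; rewrite /nonlinear_or_long ?negb_or ?u0 //.
- by case/orP => [/ul->//|/ll->]; rewrite orbT.
- by case/orP => [/ur->//|/lr->]; rewrite orbT.
- by case/orP => [/(uf _ _ f0)->//|/(lf _ _ f0)->]; rewrite orbT.
Qed.

Lemma fic_nilpotent n : 0 < n -> fic (collapse eq (long n)).
Proof. by move=> n0; apply: fic_collapse; [exact: fic_eq|exact: ideal_long|move=> s t ->]. Qed.

Lemma fic_perm_collapse I : fi_ideal I -> (forall s t, perm_eq s t -> I s -> I t) ->
  fic (collapse perm_eq I).
Proof. by move=> idI; apply: fic_collapse => //; exact: fic_perm. Qed.

Lemma perm_long n s t : perm_eq s t -> long n s -> long n t.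
Proof. by rewrite /long => /perm_size ->. Qed.

Lemma perm_nonlinear s t : perm_eq s t -> nonlinear s -> nonlinear t.
Proof. by rewrite /nonlinear => /perm_uniq ->. Qed.

Lemma perm_nonlinear_or_long n s t :
  perm_eq s t -> nonlinear_or_long n s -> nonlinear_or_long n t.
Proof.
move=> st /orP[/(perm_nonlinear st) H|/(perm_long st) H]; apply/orP; [by left|by right].
Qed.

(** Each variety is given by its whole equational theory. Shorter bases are
    [xy = x] for [LZ], [xy = y] for [RZ], and the semilattice identities
    [xy = yx], [x^2 = x] for [SL]. *)
Definition LZ := var_of same_head.
Definition RZ := var_of same_last.
Definition SL := var_of same_content.
(** For [d > 0], the abelian groups of exponent dividing [d]; this is the
    trivial variety for [d = 1]. *)
Definition AB d := var_of (same_count_mod d).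
Definition COM := var_of perm_eq.
(** The variety defined by [x1 ... xn = 0]. *)
Definition NIL n := var_of (collapse eq (long n)).
(** Null semigroups, [xy = 0]. *)
Definition ZM := NIL 2.
Definition CNIL n := var_of (collapse perm_eq (long n)).
(** The variety defined by [xy = yx] and [x^2 = 0]: the nonzero words are the
    linear ones, so it is the least nil variety that is not nilpotent. *)
Definition CLIN := var_of (collapse perm_eq nonlinear).
Definition CLIN_NIL n := var_of (collapse perm_eq (nonlinear_or_long n)).

Lemma eqn_LZ s t : eqn LZ s t <-> same_head s t.
Proof. exact/eqn_var_of/fic_same_head. Qed.
Lemma eqn_RZ s t : eqn RZ s t <-> same_last s t.
Proof. exact/eqn_var_of/fic_same_last. Qed.
Lemma eqn_SL s t : eqn SL s t <-> same_content s t.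
Proof. exact/eqn_var_of/fic_same_content. Qed.
Lemma eqn_AB d s t : eqn (AB d) s t <-> same_count_mod d s t.
Proof. exact/eqn_var_of/fic_same_count_mod. Qed.
Lemma eqn_COM s t : eqn COM s t <-> perm_eq s t.
Proof. exact/eqn_var_of/fic_perm. Qed.
Lemma eqn_NIL n s t : 0 < n -> eqn (NIL n) s t <-> collapse eq (long n) s t.
Proof. by move=> n0; exact/eqn_var_of/fic_nilpotent. Qed.
Lemma eqn_ZM s t : eqn ZM s t <-> collapse eq (long 2) s t.
Proof. exact: eqn_NIL. Qed.
Lemma eqn_CNIL n s t : 0 < n -> eqn (CNIL n) s t <-> collapse perm_eq (long n) s t.
Proof.
by move=> n0; apply/eqn_var_of/fic_perm_collapse; [exact: ideal_long|exact: perm_long].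
Qed.
Lemma eqn_CLIN s t : eqn CLIN s t <-> collapse perm_eq nonlinear s t.
Proof.
by apply/eqn_var_of/fic_perm_collapse; [exact: ideal_nonlinear|exact: perm_nonlinear].
Qed.
Lemma eqn_CLIN_NIL n s t : 0 < n ->
  eqn (CLIN_NIL n) s t <-> collapse perm_eq (nonlinear_or_long n) s t.
Proof.
move=> n0; apply/eqn_var_of/fic_perm_collapse; first exact: ideal_nonlinear_or_long.
exact: perm_nonlinear_or_long.
Qed.

(** * Consequences of omitting an atom *)

(** When [E] is the theory of [V] and [F] that of [W], this says that [W] is not
    contained in [V]. *)
Definition omits (E F : seq nat -> seq nat -> Prop) : Prop :=
  ~ (forall s t, E s t -> F s t).

Lemma omitsP E F : omits E F -> exists s t, E s t /\ ~ F s t.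
Proof. by move/existsNP => [s /existsNP[t /not_implyP[]]]; exists s, t. Qed.

Definition rep (n : nat) (u : seq nat) : seq nat := flatten (nseq n u).

Lemma rep0 u : rep 0 u = [::]. Proof. by []. Qed.
Lemma repS n u : rep n.+1 u = u ++ rep n u. Proof. by []. Qed.
Lemma rep1 u : rep 1 u = u. Proof. exact: cats0. Qed.
Lemma repD m n u : rep (m + n) u = rep m u ++ rep n u.
Proof. by rewrite /rep nseqD flatten_cat. Qed.
Lemma repSr n u : rep n.+1 u = rep n u ++ u.
Proof. by rewrite -addn1 repD rep1. Qed.
Lemma rep_letter n x : rep n [:: x] = nseq n x.
Proof. by elim: n => // n IH; rewrite repS IH. Qed.
Lemma rep_eq_nil n u : (rep n u == [::]) = (n == 0) || (u == [::]).
Proof. by elim: n => // n IH; rewrite repS cat_eq_nil IH; case: (u == _); rewrite ?orbT. Qed.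
Lemma rev_rep n u : rev (rep n u) = rep n (rev u).
Proof. by elim: n => // n IH; rewrite repS rev_cat IH -repSr. Qed.
Lemma subst_nseq f n x : subst f (nseq n x) = rep n (f x).
Proof. by rewrite /subst /rep map_nseq. Qed.

Lemma subst_powers g y s :
  subst (fun x => nseq (g x) y) s = nseq (\sum_(x <- s) g x) y.
Proof.
by elim: s => [|x s IH]; rewrite ?big_nil // subst_cons IH big_cons nseqD.
Qed.

Lemma sum_two_values (x a b : nat) (s : seq nat) :
  \sum_(y <- s) (if y == x then a else b) =
  a * count_mem x s + b * (size s - count_mem x s).
Proof.
elim: s => [|y s IH]; first by rewrite big_nil !muln0.
have := count_size (pred1 x) s; rewrite big_cons IH /=; case: (y == x) => /=; nia.
Qed.

(** Congruences are rewritten with in the way of an equality of words. *)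
Existing Class fic.

#[local] Instance fic_equivalence E : fic E -> Equivalence E.
Proof.
move=> ficE; split; [exact: (fic_refl ficE)|exact: (fic_sym ficE)|].
by move=> s t u; exact: (fic_trans ficE).
Qed.

#[local] Instance fic_cat_proper E : fic E -> Proper (E ==> E ==> E) (@cat nat).
Proof. by move=> ficE s t st s' t'; exact: (fic_cat ficE). Qed.

Section Congruence.
Variables (E : seq nat -> seq nat -> Prop) (ficE : fic E).
Local Notation "s ~ t" := (E s t) (at level 70).

Lemma sim_neq_nil s t : s ~ t -> (s == [::]) = (t == [::]).
Proof.
move=> st; apply/eqP/eqP => e; first by apply: (fic_nil ficE); rewrite -e.
by apply: (fic_nil ficE); rewrite -e; symmetry.
Qed.

Lemma sim_powers g y s t : (forall x, 0 < g x) -> s ~ t ->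
  nseq (\sum_(x <- s) g x) y ~ nseq (\sum_(x <- t) g x) y.
Proof.
move=> g0 st; rewrite -!subst_powers; apply: (fic_subst ficE) => // x.
by case: (g x) (g0 x).
Qed.

(** For the least period [d], a power identity [x^i = x^j] whose exponents
    disagree modulo [d] would give, for large exponents, a smaller period:
    the remainder of [j - i]. *)
Lemma period_exists i j : i < j -> nseq i 0 ~ nseq j 0 ->
  exists2 d, 0 < d & (exists2 a, 0 < a & nseq a 0 ~ nseq (a + d) 0) /\
    forall i j, nseq i 0 ~ nseq j 0 -> i = j %[mod d].
Proof.
move=> ij Pij.
have shift k m n : nseq m 0 ~ nseq n 0 -> nseq (m + k) 0 ~ nseq (n + k) 0.
  by move=> H; rewrite !nseqD H; reflexivity.
pose Q d := `[< 0 < d /\ exists2 a, 0 < a & nseq a 0 ~ nseq (a + d) 0 >].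
have exQ : exists d, Q d.
  exists (j - i); apply/asboolP; split; first by rewrite subn_gt0.
  exists (i + 1); first by rewrite addn1.
  by have := shift 1 _ _ Pij; congr (_ ~ nseq _ _); lia.
case: (ex_minnP exQ) => d /asboolP[d0 [a a0 Pa]] dmin.
exists d => //; split; first by exists a.
have steps A q : a <= A -> nseq A 0 ~ nseq (A + q * d) 0.
  move=> aA; elim: q => [|q IH]; first by rewrite addn0; reflexivity.
  have -> : A + q.+1 * d = a + d + (A - a + q * d) by lia.
  rewrite IH; have -> : A + q * d = a + (A - a + q * d) by lia.
  exact: shift.
suff main i' r : nseq i' 0 ~ nseq (i' + r) 0 -> r %% d = 0.
  move=> {i j ij Pij} i j Pij; wlog ij : i j Pij / i <= j => [W|].
    case/orP: (leq_total i j) => ij; first exact: W.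
    by apply/esym/W => //; symmetry.
  have := main i (j - i); rewrite subnKC // => /(_ Pij) e.
  by rewrite -(subnKC ij) -modnDmr e addn0.
move=> Pr; apply/eqP; apply: contraT; rewrite -lt0n => r0.
have : d <= r %% d; last by rewrite leqNgt ltn_mod d0.
apply: dmin; apply/asboolP; split=> //; exists (a + i'); first by rewrite ltn_addr.
transitivity (nseq (a + i' + r) 0).
  by have := shift a _ _ Pr; congr (nseq _ _ ~ nseq _ _); lia.
rewrite {1}(divn_eq r d).
have -> : a + i' + (r %/ d * d + r %% d) = a + i' + r %% d + r %/ d * d by lia.
by symmetry; apply: steps; lia.
Qed.

(** If a prime [p] divided the least period [d] of [x], take an identity that
    violates the counts of a letter modulo [p], and replace the other letters
    by [x^d]: the result is a power identity whose exponents disagree modulo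
    [p]. So [d = 1]. *)
Lemma omit_groups : (forall p, prime p -> omits E (same_count_mod p)) ->
  exists2 a, 0 < a & forall u, rep a u ~ rep a.+1 u.
Proof.
move=> noA.
have witness p : prime p -> exists x s t, s ~ t /\
    count_mem x s <> count_mem x t %[mod p].
  move=> /noA/omitsP[s [t [st /not_andP[]]]]; first by rewrite (sim_neq_nil st).
  by case/existsNP => x; exists x, s, t.
have [d d0 [[a a0 Pa] dP]] : exists2 d, 0 < d &
    (exists2 a, 0 < a & nseq a 0 ~ nseq (a + d) 0) /\
    forall i j, nseq i 0 ~ nseq j 0 -> i = j %[mod d].
  have [i [j [ij Pij]]] : exists i j, i != j /\ nseq i 0 ~ nseq j 0.
    have [x [s [t [st ne]]]] := witness 2 isT.
    (* The two sides differ in length, or else they do so once x is counted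
       twice, because they have different counts of x. *)
    have g0 k : 0 < k -> forall y, 0 < (if y == x then k else 1).
      by move=> k0 y; case: ifP.
    have := sim_powers 0 (g0 1 isT) st; have := sim_powers 0 (g0 2 isT) st.
    rewrite !sum_two_values; set i := 2 * _ + _; set j := 2 * _ + _.
    have [ij _|ij Pij _] := eqVneq i j; last by exists i, j.
    set k := 1 * _ + _; set l := 1 * _ + _ => Pkl; exists k, l; split=> //.
    apply/eqP => kl; case: ne; congr (_ %% _).
    have := count_size (pred1 x) s; have := count_size (pred1 x) t; lia.
  case: (ltngtP i j) ij => // ij _; first exact: period_exists ij Pij.
  by apply: period_exists ij _; symmetry.
have d1 : d = 1.
  apply/eqP; rewrite eqn_leq d0 andbT leqNgt; apply/negP => d1.
  have [x [s [t [st []]]]] := witness _ (pdiv_prime d1).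
  have g0 y : 0 < (if y == x then 1 else d) by case: ifP.
  have := dP _ _ (sim_powers 0 g0 st); rewrite !sum_two_values !mul1n.
  rewrite -modnDmr modnMr addn0 -[X in _ = X -> _]modnDmr modnMr addn0 => e.
  by rewrite -(modn_dvdm _ (pdiv_dvd d)) e modn_dvdm // pdiv_dvd.
exists a => // u; case: (eqVneq u [::]) => [->|u0].
  by rewrite /rep; elim: a {a0 Pa} => //=; reflexivity.
have := fic_subst ficE (f := fun=> u) (fun _ => u0) Pa.
by rewrite !subst_nseq d1 addn1.
Qed.

Section Aperiodic.
Variables (a : nat) (a0 : 0 < a) (repa : forall u, rep a u ~ rep a.+1 u).

Lemma rep_absorb u k : rep a u ~ rep (a + k) u.
Proof.
elim: k => [|k IH]; first by rewrite addn0; reflexivity.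
by rewrite addnS repS -IH -repS -repa; reflexivity.
Qed.

Lemma rep_idem u : rep a u ++ rep a u ~ rep a u.
Proof. by rewrite -repD; symmetry; apply: rep_absorb. Qed.

Lemma rep_neq_nil u : u != [::] -> rep a u != [::].
Proof. by move=> u0; rewrite rep_eq_nil negb_or u0 -lt0n a0. Qed.

(** An identity whose right side lacks a letter [z] of the left side turns
    into [e = e g^k] when [z] becomes [g = e v e] and the other letters become
    the idempotent [e]; so [g] is invertible in the local monoid of [e], and it
    is [e] since groups are trivial. *)
Lemma omit_SL : omits E same_content ->
  forall u v : seq nat, u != [::] -> v != [::] -> rep a u ++ v ++ rep a u ~ rep a u.
Proof.
case/omitsP => s [t [st /existsNP[z /eqP nst]]] u v u0 v0.
wlog {nst} [zs zt] : s t st / z \in s /\ z \notin t => [W|].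
  case zs : (z \in s) nst; case zt : (z \in t) => // _.
    by apply: (W s t); rewrite ?zs ?zt.
  by apply: (W t s); rewrite ?zs ?zt //; symmetry.
set e := rep a u; pose g := e ++ v ++ e; pose h x := if x == z then g else e.
have ee : e ++ e ~ e by exact: rep_idem.
have e0 : e != [::] by exact: rep_neq_nil.
have h0 x : h x != [::] by rewrite /h /g; case: ifP => // _; rewrite cat_eq_nil negb_and e0.
have hs r : e ++ subst h r ~ e ++ rep (count_mem z r) g.
  elim: r => [|x r IH]; first by reflexivity.
  rewrite subst_cons /= [h x]/h; case: eqP => _.
    by rewrite add1n repS /g -!catA -/g IH; reflexivity.
  by rewrite add0n catA ee; exact: IH.
have ht : e ++ subst h t ~ e.
  by rewrite hs (count_memPn zt) rep0 cats0; reflexivity.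
set k := count_mem z s in hs.
have egk : e ++ rep k g ~ e.
  by rewrite -hs (fic_subst ficE h0 st).
have k0 : 0 < k by rewrite /k -has_count has_pred1.
have egm m : e ++ rep (m * k) g ~ e.
  elim: m => [|m IH]; first by rewrite cats0; reflexivity.
  by rewrite mulSn repD catA egk.
have eg : e ++ g ~ g by rewrite /g catA ee; reflexivity.
have gm : rep (a * k) g ~ rep (a * k).+1 g.
  have -> : a * k = a + (a * k - a) by nia.
  by rewrite -addnS -!rep_absorb; reflexivity.
by rewrite -/g -eg -{1}(egm a) -catA -repSr -gm; exact: egm.
Qed.

(** Take an identity whose sides start with different letters [x] and [y],
    replace [x] by [e] and the other letters by [f], and multiply by [e] on the
    right: since [e w e = e] and [f w f = f], the sides become [e] and [f e]. *)
Lemma omit_LZ :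
  (forall u v : seq nat, u != [::] -> v != [::] -> rep a u ++ v ++ rep a u ~ rep a u) ->
  omits E same_head ->
  forall u v : seq nat, u != [::] -> v != [::] -> rep a u ~ rep a v ++ rep a u.
Proof.
move=> sandwich /omitsP[s [t [st nst]]] u v u0 v0.
case: s t st nst => [|x s] [|y t] st nst;
  [by case: nst|by have := sim_neq_nil st|by have := sim_neq_nil st|].
have {nst} xy : (y == x) = false by apply/eqP => e; apply: nst; rewrite e.
set e := rep a u; set f := rep a v.
have e0 : e != [::] by exact: rep_neq_nil.
have f0 : f != [::] by exact: rep_neq_nil.
have ee : e ++ e ~ e by exact: rep_idem.
pose h z := if z == x then e else f.
have h0 z : h z != [::] by rewrite /h; case: ifP.
have := fic_subst ficE h0 st; rewrite !subst_cons /h eqxx xy -/h => H.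
transitivity (e ++ subst h s ++ e).
  case: (eqVneq (subst h s) [::]) => [->|n0]; first by symmetry.
  by symmetry; apply: sandwich.
rewrite catA H; case: (eqVneq (subst h t) [::]) => [->|n0].
  by rewrite cats0; reflexivity.
have efe : e ++ f ++ e ~ e by exact: sandwich.
have w0 : subst h t ++ e != [::] by rewrite cat_eq_nil negb_and n0.
have sw : f ++ (subst h t ++ e) ++ f ~ f by exact: sandwich.
by rewrite -{2}sw -!catA efe; reflexivity.
Qed.

End Aperiodic.
End Congruence.

Lemma omits_reversed E F : omits E F -> omits (reversed E) (reversed F).
Proof.
by move=> nEF H; apply: nEF => s t; have := H (rev s) (rev t); rewrite /reversed !revK.
Qed.

Lemma rev_eq_nil (s : seq nat) : (rev s == [::]) = (s == [::]).
Proof. by rewrite -!size_eq0 size_rev. Qed.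

Lemma omit_RZ E a : fic E -> 0 < a -> (forall u, E (rep a u) (rep a.+1 u)) ->
  (forall u v : seq nat, u != [::] -> v != [::] -> E (rep a u ++ v ++ rep a u) (rep a u)) ->
  omits E same_last ->
  forall u v : seq nat, u != [::] -> v != [::] -> E (rep a u) (rep a u ++ rep a v).
Proof.
move=> ficE a0 repa sandwich noR u v u0 v0.
suff : reversed E (rep a (rev u)) (rep a (rev v) ++ rep a (rev u)).
  by rewrite /reversed rev_cat !rev_rep !revK.
apply: (omit_LZ (fic_reversed ficE)) => //; rewrite ?rev_eq_nil //.
- by move=> w; rewrite /reversed !rev_rep.
- move=> w w' w0 w0'; rewrite /reversed !rev_cat !rev_rep -catA; apply: sandwich;
  by rewrite rev_eq_nil.
- by rewrite -[same_head]reversedK; apply: omits_reversed noR.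
Qed.

(** An identity that fails for null semigroups has a letter as one side. Sending
    this letter to [x] and all others to [x^2] gives [x = x^(m+1)], with [m]
    positive even if the other side is a letter too. *)
Lemma omit_ZM E : fic E -> omits E (collapse eq (long 2)) ->
  exists2 m, 0 < m & E [:: 0] (nseq m.+1 0).
Proof.
move=> ficE /omitsP[s [t [st nst]]].
wlog s1 : s t st nst / size s = 1 => [W|].
  have [s1|s1] := eqVneq (size s) 1; first exact: (W s t).
  have [t1|t1] := eqVneq (size t) 1.
    apply: (W t s) => //; first exact: (fic_sym ficE).
    by case=> [e|[ls lt]]; apply: nst; [left|right].
  case: nst; have := sim_neq_nil ficE st; rewrite -!size_eq0 /collapse /long.
  case: (s) (t) s1 t1 => [|x [|y r]] [|x' [|y' r']] //; by [left|right].
case: s s1 st nst => [|x [|? ?]] // _ st nst.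
have t0 : t != [::] by rewrite -(sim_neq_nil ficE st).
have [e|txs] := eqVneq t [:: x]; first by case: nst; left.
pose g y := if y == x then 1 else 2.
have g0 y : 0 < g y by rewrite /g; case: ifP.
have := sim_powers ficE 0 g0 st; rewrite big_seq1 {1}/g eqxx /= => H.
suff : 1 < \sum_(y <- t) g y.
  by case: (\sum_(y <- t) g y) H => [|[|m]] // H _; exists m.+1.
case: t t0 txs {st nst H} => [|y [|z t]] // _; last first.
  by rewrite !big_cons => _; have := g0 y; have := g0 z; lia.
by rewrite big_seq1 /g; case: (eqVneq y x) => // ->; rewrite eqxx.
Qed.

Definition nil_exponent (E : seq nat -> seq nat -> Prop) (a : nat) : Prop :=
  [/\ 0 < a, forall u v : seq nat, u != [::] -> v != [::] -> E (rep a u) (rep a v),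
      forall u v : seq nat, u != [::] -> E (rep a u ++ v) (rep a u) &
      forall u v : seq nat, u != [::] -> E (v ++ rep a u) (rep a u)].

Section Classification.
Variables (E : seq nat -> seq nat -> Prop) (ficE : fic E).
Hypothesis noAB : forall p, prime p -> omits E (same_count_mod p).
Local Notation "s ~ t" := (E s t) (at level 70).

(** For the idempotents [e = u^a] and [f = v^a], omitting left and right zero
    semigroups gives [e = f e = f]. Hence all [a]-th powers are equal, and their
    common value absorbs [v] since [v^a v = v^a]. *)
Lemma omit_all_but_ZM :
  omits E same_content -> omits E same_head -> omits E same_last ->
  exists a, nil_exponent E a.
Proof.
move=> noSL noLZ noRZ; have [a a0 repa] := omit_groups ficE noAB.
have sandwich := omit_SL ficE a0 repa noSL.
have L := omit_LZ ficE a0 repa sandwich noLZ.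
have R := omit_RZ ficE a0 repa sandwich noRZ.
have zz (u v : seq nat) : u != [::] -> v != [::] -> rep a u ~ rep a v.
  move=> u0 v0; transitivity (rep a v ++ rep a u); first exact: L.
  by symmetry; exact: R.
exists a; split=> // u v u0; case: (eqVneq v [::]) => [->|v0]; rewrite ?cats0; try by reflexivity.
- by rewrite (zz u v u0 v0) -repSr -repa; reflexivity.
- by rewrite (zz u v u0 v0) -repS -repa; reflexivity.
Qed.

(** Iterate [x = x^(m+1)] until the exponent exceeds [a], where [x^a = x^(a+1)]
    applies. *)
Lemma omit_ZM_band : omits E (collapse eq (long 2)) -> forall u, u ~ u ++ u.
Proof.
move=> noZM; have [m m0 Pm] := omit_ZM ficE noZM; have [a a0 repa] := omit_groups ficE noAB.
move=> u; case: (eqVneq u [::]) => [->|u0]; first by reflexivity.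
have {}Pm : u ~ u ++ rep m u.
  have := fic_subst ficE (f := fun=> u) (fun _ => u0) Pm.
  by rewrite (subst_nseq _ 1) subst_nseq rep1.
have Pk k : u ~ u ++ rep (k * m) u.
  elim: k => [|k IH]; first by rewrite cats0; reflexivity.
  by rewrite mulSn repD catA -Pm.
have e : rep (a * m) u ~ rep (a * m).+1 u.
  have -> : a * m = a + (a * m - a) by nia.
  by rewrite -addnS -!(rep_absorb ficE repa); reflexivity.
by rewrite {1}(Pk a) e repSr catA -Pk; reflexivity.
Qed.

(** These are bands with [x y x = x], that is, rectangular bands, and those that
    omit right zero semigroups satisfy [x = x y]. *)
Lemma omit_all_but_LZ : omits E (collapse eq (long 2)) ->
  omits E same_content -> omits E same_last -> forall s t, same_head s t -> s ~ t.
Proof.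
move=> noZM noSL noRZ; have band := omit_ZM_band noZM.
have rep1E u : rep 1 u ~ rep 2 u by rewrite (repS 1) !rep1; exact: band.
have R := omit_RZ ficE (ltn0Sn 0) rep1E (omit_SL ficE (ltn0Sn 0) rep1E noSL) noRZ.
have H x s : x :: s ~ [:: x].
  case: s => [|y s]; first by reflexivity.
  by symmetry; have := R [:: x] (y :: s) isT isT; rewrite !rep1.
case=> [|x s] [|y t] //.
by case=> <-; transitivity [:: x]; [|symmetry]; apply: H.
Qed.

Lemma omit_all : omits E (collapse eq (long 2)) ->
  omits E same_content -> omits E same_head -> omits E same_last ->
  forall s t, s != [::] -> t != [::] -> s ~ t.
Proof.
move=> noZM noSL noLZ noRZ s t s0 t0; have band := omit_ZM_band noZM.
have rep1E u : rep 1 u ~ rep 2 u by rewrite (repS 1) !rep1; exact: band.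
have sw := omit_SL ficE (ltn0Sn 0) rep1E noSL.
have := omit_RZ ficE (ltn0Sn 0) rep1E sw noRZ s0 t0.
have := omit_LZ ficE (ltn0Sn 0) rep1E sw noLZ t0 s0.
by rewrite !rep1 => Lt Rs; transitivity (s ++ t); [|symmetry].
Qed.

(** Every word is equal to the product of its distinct letters. *)
Lemma commutative_band : (forall u, u ~ u ++ u) -> (forall s t, perm_eq s t -> s ~ t) ->
  forall s t, same_content s t -> s ~ t.
Proof.
move=> band comm s t st.
have U r : r ~ undup r.
  elim: r => [|x r IH] /=; first by reflexivity.
  case: ifP => xr; last exact: (fic_cat ficE (fic_refl ficE [:: x]) IH).
  rewrite -IH; have rx : r ~ [:: x] ++ rem x r by apply/comm/perm_to_rem.
  transitivity ([:: x] ++ [:: x] ++ rem x r).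
    exact: (fic_cat ficE (fic_refl ficE [:: x]) rx).
  by rewrite catA -(band [:: x]); symmetry.
rewrite (U s) (U t); apply/comm/uniq_perm; rewrite ?undup_uniq // => x.
by rewrite !mem_undup st.
Qed.

End Classification.

Lemma omits_reversed_sub E F G : (forall s t, reversed F s t -> G s t) ->
  omits E G -> omits (reversed E) F.
Proof.
move=> FG noG H; apply: noG => s t st; apply: FG; rewrite /reversed; apply: H.
by rewrite /reversed !revK.
Qed.

Lemma omit_all_but_RZ E : fic E -> (forall p, prime p -> omits E (same_count_mod p)) ->
  omits E (collapse eq (long 2)) -> omits E same_content -> omits E same_head ->
  forall s t, same_last s t -> E s t.
Proof.
move=> ficE noAB noZM noSL noLZ s t st; rewrite -[s]revK -[t]revK.
apply: (omit_all_but_LZ (fic_reversed ficE)) => //.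
- move=> p pp; apply: omits_reversed_sub (noAB p pp) => u v [e H].
  split=> [|x]; first by rewrite -[u == _]rev_eq_nil e rev_eq_nil.
  by rewrite -[count _ u]count_rev H count_rev.
- apply: omits_reversed_sub noZM => u v [/(congr1 rev)|]; rewrite ?revK; first by left.
  by rewrite /long !size_rev; right.
- by apply: omits_reversed_sub noSL => u v uv x; rewrite -mem_rev uv mem_rev.
- by apply: omits_reversed_sub noLZ => u v; rewrite /reversed /same_last !revK.
Qed.

(** * Nil varieties that omit the linear commutative one *)

Section Nilpotency.
Variables (E : seq nat -> seq nat -> Prop) (ficE : fic E) (a : nat).
Hypothesis nilE : nil_exponent E a.
Local Notation "s ~ t" := (E s t) (at level 70).

(** The letters [f^i(x)], for [x] in [s], are coded by their indices in [s], so
    the iterates live in a finite type. *)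
Lemma orbit_repeats (s : seq nat) (f : nat -> nat) : {homo f : x / x \in s} ->
  exists i j, i < j /\ map (iter i f) s = map (iter j f) s.
Proof.
move=> fs; set k := size s; pose T := {ffun 'I_k -> 'I_k.+1}.
have ms i x : x \in s -> iter i f x \in s.
  by move=> xs; elim: i => //= i; apply: fs.
pose g (i : 'I_#|T|.+1) : T := [ffun q : 'I_k => inord (index (iter i f (nth 0 s q)) s)].
have /injectivePn[i [j ij gij]] : ~~ injectiveb g.
  by apply/injectiveP => /leq_card; rewrite card_ord ltnn.
have uij : map (iter i f) s = map (iter j f) s.
  apply/(@eq_from_nth _ 0); rewrite !size_map // => q qk.
  have := congr1 (fun h : T => val (h (Ordinal qk))) gij.
  rewrite !ffunE /= !inordK ?ltnS ?index_size // !(nth_map 0) // => e.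
  by rewrite -(nth_index 0 (ms i _ (mem_nth 0 qk))) e nth_index // ms // mem_nth.
case: (ltngtP i j) ij => [lt_ij|lt_ji|/val_inj ->]; last by rewrite eqxx.
  by exists i, j.
by exists j, i.
Qed.

(** Renaming letters by the map [f] that sends [s] to the prefix of [t], the
    identity [s = t] reads [s = f(s) b]; once the powers of [f] start to
    repeat on the letters of [s], some [f^i(s)] is equal to a product
    [f^i(s) c], hence to zero. *)
Lemma linear_lengthened (s t : seq nat) : uniq s -> s ~ t -> size s < size t -> s ~ rep a [:: 0].
Proof.
case: nilE => a0 zz zl zr Us st lt_st.
wlog ts : t st lt_st / {subset t <= s} => [W|].
  (* The letters of t that do not occur in s may be replaced by any letter of s. *)
  pose h x := if x \in s then x else head 0 s.
  have hs : map h s = s by apply: map_id_in => x xs; rewrite /h xs.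
  apply: (W (map h t)); last 1 first.
  - move=> _ /mapP[x _ ->]; rewrite /h; case: ifP => //.
    case: (s) st lt_st => [/(fic_nil ficE) ->//|y r] _ _ _; exact: mem_head.
  - by rewrite -{1}hs -!subst_letters; apply: (fic_subst ficE).
  - by rewrite size_map.
pose f x := nth 0 t (index x s); set b := drop (size s) t.
have b0 : b != [::] by rewrite -size_eq0 size_drop subn_eq0 -ltnNge.
have fs : map f s = take (size s) t.
  apply/(@eq_from_nth _ 0); first by rewrite size_map size_takel // ltnW.
  move=> i; rewrite size_map => i_s.
  by rewrite (nth_map 0) // nth_take // /f index_uniq.
have f_s : {homo f : x / x \in s}.
  by move=> x xs; apply/ts/mem_nth/(ltn_trans _ lt_st); rewrite index_mem.
pose u i := map (iter i f) s.
have u1 i : u i ~ u i.+1 ++ map (iter i f) b.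
  have -> : u i.+1 = map (iter i f) (map f s).
    by rewrite -map_comp; apply: eq_map => x /=; rewrite -iterSr.
  rewrite -map_cat fs cat_take_drop /u -!subst_letters.
  exact: (fic_subst ficE).
have uu i k : exists2 c, c != [::] & u i ~ u (i + k.+1) ++ c.
  elim: k => [|k [c c0 IH]].
    by rewrite addn1; exists (map (iter i f) b); rewrite // -size_eq0 size_map size_eq0.
  exists (map (iter (i + k.+1) f) b ++ c); first by rewrite cat_eq_nil negb_and c0 orbT.
  by rewrite addnS catA -u1.
have [i [j [ij e]]] := orbit_repeats f_s.
have [c c0] := uu i (j - i.+1); have -> : i + (j - i.+1).+1 = j by lia.
rewrite {2}/u -e -/(u i) => uc.
have ui0 : u i ~ rep a [:: 0].
  have um m : u i ~ u i ++ rep m c.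
    elim: m => [|m IH]; first by rewrite cats0; reflexivity.
    by rewrite repS catA -uc.
  by rewrite (um a) zr // zz //; reflexivity.
case: i {ij e uc} ui0 => [|i] ui0; first by rewrite /u map_id in ui0.
have [d d0] := uu 0 i; rewrite {1}/u map_id add0n ui0 zl //.
Qed.

(** An identity that fails in [CLIN] has a linear side [s], and its other side
    [t] is not a permutation of [s]. Either [t] is longer than [s], or it lacks
    a letter [x] of [s], and doubling [x] lengthens [s] while leaving [t]
    unchanged. So [s] is zero, and every word at least as long as [s] is an
    instance of [s]. *)
Lemma nil_nilpotent : omits E (collapse perm_eq nonlinear) ->
  exists2 n, 0 < n & forall s t, long n s -> long n t -> s ~ t.
Proof.
case: (nilE) => a0 zz zl zr /omitsP[s [t [st nst]]].
wlog Us : s t st nst / uniq s => [W|].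
  have [Us|Us] := boolP (uniq s); first exact: (W s t).
  have [Ut|Ut] := boolP (uniq t); last by case: nst; right.
  apply: (W t s) => //; first by symmetry.
  by case=> [p|[Nt Ns]]; apply: nst; [left; rewrite perm_sym|right].
have s0 : s != [::].
  apply/eqP => s0; apply: nst; rewrite s0 in st *.
  by rewrite (fic_nil ficE st); left.
have [t' st' lt_st'] : exists2 t', s ~ t' & size s < size t'.
  have [sub|/allPn[x xs xt]] := boolP (all [in t] s).
    exists t => //; rewrite ltn_neqAle uniq_leq_size ?andbT //; last exact/allP.
    apply/eqP => e; apply: nst; left; apply: uniq_perm => //.
      by apply: (leq_size_uniq Us); [exact/allP|rewrite e].
    by have [|//|_] := uniq_min_size Us (s2 := t); [exact/allP|rewrite e|].
  pose h y := if y == x then [:: y; y] else [:: y].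
  have h0 y : h y != [::] by rewrite /h; case: ifP.
  have ht : subst h t = t.
    rewrite -[RHS]flatten_seq1; congr flatten; apply/eq_in_map => y yt.
    by rewrite /h; case: eqP => // e; rewrite -e yt in xt.
  exists (subst h s); first by transitivity t => //; rewrite -ht; symmetry; apply: (fic_subst ficE).
  have : forall r, size r + count_mem x r = size (subst h r).
    elim=> // y r IH; rewrite subst_cons size_cat -IH /h /=; case: eqP => /= _; lia.
  by move=> <-; rewrite -[X in X < _]addn0 ltn_add2l -has_count has_pred1.
have sz := linear_lengthened Us st' lt_st'.
exists (size s) => [|w w']; first by rewrite lt0n size_eq0.
suff {w w'} H w : long (size s) w -> w ~ rep a [:: 0].
  by move=> lw lw'; rewrite (H _ lw) (H _ lw'); reflexivity.
move=> lw; have [g g0 <-] := linear_subst s0 Us lw.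
have := fic_subst ficE g0 sz; rewrite rep_letter subst_nseq => ->; rewrite -rep_letter.
exact: zz.
Qed.

End Nilpotency.

(** * Long words in strongly permutative varieties *)

Section Permutation.
Variables (E : seq nat -> seq nat -> Prop) (ficE : fic E).
Local Notation "s ~ t" := (E s t) (at level 70).

(** In [v] the first letter [x] of [u] is preceded by some letter [w]. Putting
    [y] between [w] and [x] can be done on either of them, but in [u] the two
    choices put [y] before or after the factor from [x] to [w]. *)
Lemma letter_jumps_block u v : uniq u -> perm_eq u v -> ohead u <> ohead v -> u ~ v ->
  exists l r, forall y B C, l <= size B -> r <= size C -> y ++ B ++ C ~ B ++ y ++ C.
Proof.
case: u => [|x u] Uu uv xv uEv; first by case: v uv xv uEv => // ? ? /perm_size.
have Uv : uniq v by rewrite -(perm_uniq uv).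
have xv' : x \in v by rewrite -(perm_mem uv) mem_head.
case/splitPr: xv' uEv Uv uv xv => v1' v2; case: (lastP v1') => [//|v1 w {v1'}].
rewrite cat_rcons => uEv Uv uv _.
have wu : w \in u.
  have : w \in x :: u by rewrite (perm_mem uv) mem_cat mem_head orbT.
  rewrite inE; case: eqP => // e; move: Uv; rewrite e cat_uniq /= inE eqxx /=.
  by rewrite !andbF.
case/splitPr: wu Uu uEv uv => u1 u2 Uu uEv uv.
exists (size (x :: rcons u1 w)), (size u2) => y B C lB rC.
set s := x :: rcons u1 w in lB.
(* Choose g mapping the factor s of u to B, and the rest u2 of u to a prefix of
   C; the remaining suffix C2 of C is restored by multiplication on the right. *)
have Us : uniq (s ++ u2) by rewrite /s /= cat_rcons.
have [Us1 Us2 dis] : [/\ uniq s, uniq u2 & {in u2, forall z, z \notin s}].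
  by move: Us; rewrite cat_uniq => /and3P[-> /hasPn dis ->].
have [g1 g10 g1s] := linear_subst (isT : s != [::]) Us1 lB.
have [g2 g20 [C2 g2s]] : exists2 g2, forall z, g2 z != [::] & exists C2, subst g2 u2 ++ C2 = C.
  have [->|u20] := eqVneq u2 [::]; first by exists (fun=> [:: 0]) => //; exists C.
  by have [g2 ? ?] := linear_subst u20 Us2 rC; exists g2 => //; exists [::]; rewrite cats0.
pose g z := if z \in s then g1 z else g2 z.
have g0 z : g z != [::] by rewrite /g; case: ifP.
have gs : subst g s = B by rewrite -g1s; apply: eq_subst_in => z; rewrite /g => ->.
have gu2 : subst g u2 ++ C2 = C.
  rewrite -g2s; congr (_ ++ _); apply: eq_subst_in => z /dis.
  by rewrite /g => /negbTE ->.
have xw : x != w.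
  by move: Us1; rewrite /s cons_uniq mem_rcons inE negb_or => /andP[/andP[]].
move: (Uv); rewrite cat_uniq /= inE !negb_or.
case/and5P => _ /and3P[wv1 xv1 _] /andP[_ wv2] xv2 _.
pose h1 z := if z == w then g w ++ y else g z.
pose h2 z := if z == x then y ++ g x else g z.
have hv : subst h1 (v1 ++ [:: w, x & v2]) = subst h2 (v1 ++ [:: w, x & v2]).
  rewrite !subst_cat !subst_cons /h1 /h2 !eqxx (negbTE xw) [w == x]eq_sym (negbTE xw) -!catA.
  congr (_ ++ (_ ++ (_ ++ (_ ++ _)))); apply: eq_subst_in => z zv.
    case: eqP => [e|_]; first by rewrite -e zv in wv1.
    by case: eqP => // e; rewrite -e zv in xv1.
  case: eqP => [e|_]; first by rewrite -e zv in wv2.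
  by case: eqP => // e; rewrite -e zv in xv2.
have h10 z : h1 z != [::] by rewrite /h1; case: ifP => //; rewrite cat_eq_nil negb_and g0.
have h20 z : h2 z != [::] by rewrite /h2; case: ifP => //; rewrite cat_eq_nil negb_and g0 orbT.
have u1E : x :: u1 ++ w :: u2 = s ++ u2 by rewrite /s /= cat_rcons.
have : subst h1 (s ++ u2) ~ subst h2 (s ++ u2).
  rewrite -u1E (fic_subst ficE h10 uEv) hv; symmetry; exact: (fic_subst ficE h20 uEv).
have gE f r : {in r, f =1 g} -> subst f r = subst g r by exact: eq_subst_in.
have wu1 : w \notin x :: u1 by move: Us1; rewrite /s -rcons_cons rcons_uniq => /andP[].
rewrite !subst_cat !(gE _ u2); last 2 first.
- by move=> z /dis; rewrite /s /h2 inE negb_or => /andP[/negbTE ->].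
- by move=> z /dis; rewrite /s /h1 -rcons_cons mem_rcons inE negb_or => /andP[/negbTE ->].
have -> : subst h1 s = B ++ y.
  rewrite -gs /s -rcons_cons -cats1 !subst_cat (gE h1 (x :: u1)) => [|z zu].
    by rewrite -catA /subst /= /h1 eqxx !cats0.
  by rewrite /h1; case: eqP => // e; rewrite -e zu in wu1.
have -> : subst h2 s = y ++ B.
  rewrite -gs /s !subst_cons (gE h2 (rcons u1 w)) => [|z zu].
    by rewrite /h2 eqxx catA.
  by rewrite /h2; case: eqP => // e; move: Us1; rewrite /s /= -e zu.
move=> H; symmetry; move: (fic_cat ficE H (fic_refl ficE C2)).
by rewrite -!catA gu2.
Qed.

(** Comparing jumps of [y] over [B] and over [B z] exchanges [y] and [z] to the
    right of [B]. So jump with [y z] over a block, exchange, and jump back. *)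
Lemma swap_first_letters u v : uniq u -> perm_eq u v -> ohead u <> ohead v -> u ~ v ->
  exists M, forall y z W, M <= size W -> y ++ z ++ W ~ z ++ y ++ W.
Proof.
move=> Uu uv xv uEv; have [l [r J]] := letter_jumps_block Uu uv xv uEv.
have inner y z B C : l <= size B -> r <= size C -> B ++ y ++ z ++ C ~ B ++ z ++ y ++ C.
  move=> lB rC.
  rewrite -(J y B (z ++ C)) //; last by rewrite size_cat (leq_trans rC) ?leq_addl.
  rewrite catA -catA [B ++ z ++ C]catA (J y (B ++ z) C) //.
    by rewrite -!catA; reflexivity.
  by rewrite size_cat (leq_trans lB) ?leq_addr.
exists (l + r) => y z W lW; rewrite -(cat_take_drop l W).
set B := take l W; set C := drop l W.
have lB : l <= size B by rewrite /B size_takel //; lia.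
have rC : r <= size C by rewrite /C size_drop; lia.
transitivity (B ++ (y ++ z) ++ C); first by rewrite catA; apply: J.
transitivity (B ++ (z ++ y) ++ C); first by rewrite -!catA; apply: inner.
by symmetry; rewrite catA; apply: J.
Qed.

(** The prefix [p] in the induction keeps the total length above the bound while
    the letters of [s] are put in place one by one. *)
Lemma adjacent_swaps M :
  (forall p q y z, M <= size p + size q -> p ++ [:: y; z] ++ q ~ p ++ [:: z; y] ++ q) ->
  forall s t, perm_eq s t -> M.+2 <= size s -> s ~ t.
Proof.
move=> swap.
have bubble x t1 t2 p : M.+2 <= (size p + size (t1 ++ t2)).+1 ->
    p ++ x :: t1 ++ t2 ~ p ++ t1 ++ x :: t2.
  elim: t1 p => [|y t1 IH] p; first by reflexivity.
  rewrite /= => Mp; rewrite -[p ++ _]/(p ++ [:: x; y] ++ (t1 ++ t2)) swap; last by lia.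
  by have := IH (rcons p y); rewrite size_rcons !cat_rcons; apply; lia.
suff H s t p : perm_eq s t -> M.+2 <= size p + size s -> p ++ s ~ p ++ t.
  by move=> s t st Ms; apply: (H s t [::]).
elim: s t p => [|x s IH] t p st Ms.
  by move: st; rewrite perm_sym => /perm_nilP ->; reflexivity.
have xt : x \in t by rewrite -(perm_mem st) mem_head.
case/splitPr: xt st => t1 t2; rewrite perm_sym perm_catC /= perm_cons perm_catC perm_sym => st.
rewrite -cat_rcons (IH (t1 ++ t2)) //; last by rewrite size_rcons; move: Ms => /=; lia.
by rewrite cat_rcons; apply: bubble; rewrite -(perm_size st); move: Ms => /=; lia.
Qed.

End Permutation.

Lemma long_balanced E u v : fic E -> uniq u -> perm_eq u v -> E u v ->
  ohead u <> ohead v -> ohead (rev u) <> ohead (rev v) ->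
  exists M, forall s t, perm_eq s t -> M <= size s -> E s t.
Proof.
move=> ficE Uu uv uEv hd tl.
have [M HM] := swap_first_letters ficE Uu uv hd uEv.
have [N HN] : exists N, forall y z W, N <= size W ->
    reversed E (y ++ z ++ W) (z ++ y ++ W).
  apply: (swap_first_letters (fic_reversed ficE) (u := rev u) (v := rev v)) => //.
  - by rewrite rev_uniq.
  - by rewrite perm_rev perm_sym perm_rev perm_sym.
  - by rewrite /reversed !revK.
(* With M + N letters around two adjacent ones, at least M follow them or at
   least N precede them. *)
exists (M + N).+2; apply: (adjacent_swaps ficE) => p q y z MN.
have [Mq|qM] := leqP M (size q).
  by apply: (fic_cat ficE (fic_refl ficE p)); exact: (HM [:: y] [:: z]).
have := HN [:: z] [:: y] (rev p); rewrite size_rev => /(_ ltac:(lia)).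
rewrite /reversed !rev_cat !revK -!catA /= => H.
by have := fic_cat ficE H (fic_refl ficE q); rewrite -!catA.
Qed.

(** * Atoms *)

Section LatticeNotions.
Context {d : Order.disp_t} {L : latticeType d}.
Implicit Types a b c x y z : L.

Definition is_atom a : Prop :=
  (exists b, (b < a)%O) /\ forall b, (b < a)%O -> forall c, (b <= c)%O.

Definition sole_atom a x : Prop :=
  forall b, is_atom b -> (b <= x)%O -> b = a.

Definition extensible_atom a : Prop :=
  is_atom a /\ exists x, (a < x)%O /\ sole_atom a x.

Definition lub_of_extensible c : Prop :=
  (forall a, extensible_atom a -> (a <= c)%O) /\
  forall x, (forall a, extensible_atom a -> (a <= x)%O) -> (c <= x)%O.

(** Adding [z] to [x] brings in no element that omits [z] and was not already
    below [x]; this distinguishes null semigroups from groups of prime order. *)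
Definition separable z : Prop :=
  forall x y, (y <= x `|` z)%O -> (z <= y)%O \/ (y <= x)%O.

(** An element [x] is not the bottom exactly when there is some [w < x], so this
    asks for a lower cover of every nonbottom element below [n]. *)
Definition lower_covered n : Prop :=
  forall x w, (x <= n)%O -> (w < x)%O ->
    exists y, (y < x)%O /\ forall z, (y <= z)%O -> (z < x)%O -> (z <= y)%O.

End LatticeNotions.

Lemma le_eqn (V W : variety) s t : (V <= W)%O -> eqn W s t -> eqn V s t.
Proof. by move=> /variety_leP; apply. Qed.

Lemma nle_omits E V : fic E -> ~ (var_of E <= V)%O -> omits (eqn V) E.
Proof.
move=> ficE nEV H; apply/nEV/variety_leP => s t /H; exact: (eqn_var_of ficE _ _).2.
Qed.

Lemma eqn_trivial s t : eqn (AB 1) s t <-> (s == [::]) = (t == [::]).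
Proof. by rewrite eqn_AB; split=> [[]|e] //; split=> // x; rewrite !modn1. Qed.

Lemma trivial_le V : (AB 1 <= V)%O.
Proof. by apply/variety_leP => s t /(sim_neq_nil (eqn_fic V)) /eqn_trivial. Qed.

Definition basic (V : variety) : Prop :=
  [\/ V = LZ, V = RZ, V = SL | V = ZM \/ exists2 p, prime p & V = AB p].

Lemma basic_AB p : prime p -> basic (AB p).
Proof. by move=> pp; apply: Or44; right; exists p. Qed.

Lemma basic_ZM : basic ZM. Proof. by apply: Or44; left. Qed.

Lemma prime_mod1 p : prime p -> 1 %% p = 1.
Proof. by move=> /prime_gt1; apply: modn_small. Qed.

Lemma basic_nontrivial V : basic V -> ~ eqn V [:: 0] [:: 1].
Proof.
case=> [->|->|->|[->|[p pp ->]]].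
- by rewrite eqn_LZ.
- by rewrite eqn_RZ.
- by rewrite eqn_SL => /(_ 0).
- by rewrite eqn_ZM => -[|[]].
- by rewrite eqn_AB => -[_ /(_ 0)]; rewrite /= prime_mod1 // mod0n.
Qed.

(** The identities [x^n y = y] and [y x^n = y] of [AB n] do not both hold in any
    atom but the groups of order dividing [n]. *)
Lemma basic_le_AB V n : basic V -> 0 < n -> (V <= AB n)%O ->
  exists p, [/\ prime p, p %| n & V = AB p].
Proof.
move=> bV n0 le.
have E : eqn (AB n) (nseq n 0 ++ [:: 1]) [:: 1].
  rewrite eqn_AB; split=> [|x]; first by case: (n).
  by rewrite count_cat count_nseq /=; case: (0 == x); rewrite ?mul1n ?mul0n // modnDl.
have F : eqn (AB n) ([:: 1] ++ nseq n 0) [:: 1].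
  rewrite eqn_AB; split=> [//|x].
  by rewrite count_cat count_nseq /=; case: (0 == x); rewrite ?mul1n ?mul0n ?addn0 // modnDr.
have {E}E := le_eqn le E; have {F}F := le_eqn le F.
case: bV le E F => [->|->|->|[->|[p pp ->]]] le E F.
- by move: E; rewrite eqn_LZ /same_head; case: (n) n0.
- by move: F; rewrite eqn_RZ /same_last rev_cat rev_nseq; case: (n) n0.
- by move: E; rewrite eqn_SL => /(_ 0); case: (n) n0.
- by move: E; rewrite eqn_ZM; case: (n) n0 => // m _ [|[]].
- exists p; split=> //; move: F; rewrite eqn_AB => -[_ /(_ 0)] /=.
  by rewrite count_nseq mul1n add0n mod0n => /eqP.
Qed.

(** Some identity of [W] fails in each of the other candidates for [V]. *)
Lemma basic_le V W : basic V -> basic W -> (V <= W)%O -> V = W.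
Proof.
move=> bV [->|->|->|[->|[p pp ->]]].
- have E : eqn LZ [:: 0; 1] [:: 0] by rewrite eqn_LZ.
  case: bV => [//|->|->|[->|[q qq ->]]] /le_eqn/(_ E).
  + by rewrite eqn_RZ.
  + by rewrite eqn_SL => /(_ 1).
  + by rewrite eqn_ZM => -[|[]].
  + by rewrite eqn_AB => -[_ /(_ 1)]; rewrite /= prime_mod1 // mod0n.
- have E : eqn RZ [:: 1; 0] [:: 0] by rewrite eqn_RZ.
  case: bV => [->|//|->|[->|[q qq ->]]] /le_eqn/(_ E).
  + by rewrite eqn_LZ.
  + by rewrite eqn_SL => /(_ 1).
  + by rewrite eqn_ZM => -[|[]].
  + by rewrite eqn_AB => -[_ /(_ 1)]; rewrite /= prime_mod1 // mod0n.
- have E : eqn SL [:: 0; 0; 1] [:: 1; 0].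
    by rewrite eqn_SL => x; rewrite !inE; case: (x == 0); case: (x == 1).
  have F : eqn SL [:: 0; 1; 1] [:: 1; 0].
    by rewrite eqn_SL => x; rewrite !inE; case: (x == 0); case: (x == 1).
  have G : eqn SL [:: 0; 0] [:: 0].
    by rewrite eqn_SL => x; rewrite !inE; case: (x == 0); case: (x == 1).
  case: bV => [->|->|//|[->|[q qq ->]]] le.
  + by have := le_eqn le E; rewrite eqn_LZ.
  + by have := le_eqn le F; rewrite eqn_RZ.
  + by have := le_eqn le G; rewrite eqn_ZM => -[|[]].
  + have := le_eqn le G; rewrite eqn_AB => -[_ /(_ 0)] /= /eqP.
    by rewrite eqn_mod_dvd // subSS dvdn1 => /eqP q1; rewrite q1 in qq.
- have E : eqn ZM [:: 0; 0] [:: 1; 1] by rewrite eqn_ZM; right.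
  have F : eqn ZM [:: 0; 0] [:: 0; 0; 0] by rewrite eqn_ZM; right.
  case: bV => [->|->|->|[//|[q qq ->]]] le.
  + by have := le_eqn le E; rewrite eqn_LZ.
  + by have := le_eqn le E; rewrite eqn_RZ.
  + by have := le_eqn le E; rewrite eqn_SL => /(_ 0).
  + have := le_eqn le F; rewrite eqn_AB => -[_ /(_ 0)] /= /eqP.
    by rewrite eq_sym eqn_mod_dvd // subSS dvdn1 => /eqP q1; rewrite q1 in qq.
- move=> /(basic_le_AB bV (prime_gt0 pp))[q [qq + ->]].
  by rewrite dvdn_prime2 // => /eqP ->.
Qed.

Lemma contains_basic V : ~ (V <= AB 1)%O -> exists b, basic b /\ (b <= V)%O.
Proof.
move=> nV; apply: contrapT => /forallNP noV; apply/nV/variety_leP => s t.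
have omitV b : basic b -> ~ (b <= V)%O by move=> bb bV; apply: (noV b).
have [/eqP ->|s0] := boolP (s == [::]).
  by move=> /eqn_trivial/esym/eqP ->; apply: (fic_refl (eqn_fic V)).
move=> st; have t0 : t != [::] by rewrite -(eqn_trivial s t).1.
apply: (omit_all (eqn_fic V)) => //.
- by move=> p pp; apply: nle_omits; [exact: fic_same_count_mod|exact/omitV/basic_AB].
- by apply: nle_omits; [exact: fic_nilpotent|exact/omitV/basic_ZM].
- by apply: nle_omits; [exact: fic_same_content|exact/omitV/Or43].
- by apply: nle_omits; [exact: fic_same_head|exact/omitV/Or41].
- by apply: nle_omits; [exact: fic_same_last|exact/omitV/Or42].
Qed.

Lemma atomP (V : variety) : is_atom V <-> basic V.
Proof.
split=> [[[b bV] Vmin]|bV].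
  have [|c [bc cV]] := @contains_basic V.
    move=> V1; have := lt_le_trans bV (le_trans V1 (trivial_le b)).
    by rewrite ltxx.
  move: cV; rewrite le_eqVlt => /orP[/eqP <- //|/Vmin/(_ (AB 1)) c1].
  by case: (basic_nontrivial bc); apply: (le_eqn c1); apply/eqn_trivial.
have nV1 : ~ (V <= AB 1)%O.
  by move=> V1; apply: (basic_nontrivial bV); apply: (le_eqn V1); apply/eqn_trivial.
split; first by exists (AB 1); rewrite lt_leAnge trivial_le; apply/negP.
move=> b ltbV c; apply: le_trans (trivial_le c); apply: contrapT => /contains_basic[e [be eb]].
have eV := basic_le be bV (le_trans eb (ltW ltbV)).
by have := le_lt_trans eb ltbV; rewrite eV ltxx.
Qed.

Lemma sole_atom_omits V a b : sole_atom a V -> basic b -> b <> a -> ~ (b <= V)%O.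
Proof. by move=> sV /atomP ab nba bV; apply/nba/sV. Qed.

(** * The variety of commutative semigroups *)

Lemma dvdn_AB m n : m %| n -> (AB m <= AB n)%O.
Proof.
move=> mn; apply/variety_leP => s t; rewrite !eqn_AB => -[e H]; split=> // x.
by rewrite -(modn_dvdm _ mn) H modn_dvdm.
Qed.

Lemma AB_le_COM n : (AB n <= COM)%O.
Proof.
apply/variety_leP => s t; rewrite eqn_COM eqn_AB => st; split.
  by rewrite -!size_eq0 (perm_size st).
by move=> x; rewrite (seq.permP st).
Qed.

Lemma LZ_nle_COM : ~ (LZ <= COM)%O.
Proof. by move=> /le_eqn/(_ ((eqn_COM [:: 0; 1] [:: 1; 0]).2 isT))/eqn_LZ. Qed.

Lemma RZ_nle_COM : ~ (RZ <= COM)%O.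
Proof. by move=> /le_eqn/(_ ((eqn_COM [:: 0; 1] [:: 1; 0]).2 isT))/eqn_RZ. Qed.

Lemma extensible_AB p : prime p -> extensible_atom (AB p).
Proof.
move=> pp; split; first exact/atomP/basic_AB.
exists (AB (p ^ 2)); split.
  rewrite lt_leAnge dvdn_AB ?dvdn_exp //=; apply/negP => le.
  have E : eqn (AB p) (nseq p.+1 0) [:: 0].
    rewrite eqn_AB; split=> // x; rewrite count_nseq mulnC.
    by rewrite /= addn0; case: (0 == x); rewrite ?muln0 // muln1 -addn1 modnDl.
  have := le_eqn le E; rewrite eqn_AB => -[_ /(_ 0)] /= /eqP.
  rewrite count_nseq mul1n add1n eqn_mod_dvd // subSS subn0 => /dvdn_leq.
  by rewrite (prime_gt0 pp) => /(_ isT); have := prime_gt1 pp; nia.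
move=> b /atomP bb /(basic_le_AB bb)[|q [qq]]; first by rewrite expn_gt0 prime_gt0.
by rewrite Euclid_dvdX // dvdn_prime2 // => /andP[/eqP ->].
Qed.

Lemma sole_omits E V a : fic E -> basic (var_of E) -> sole_atom a V -> var_of E <> a ->
  omits (eqn V) E.
Proof. by move=> ficE bE sV nEa; apply: nle_omits => //; apply: sole_atom_omits nEa. Qed.

Lemma sole_omits_AB V a : sole_atom a V -> (forall p, prime p -> AB p <> a) ->
  forall p, prime p -> omits (eqn V) (same_count_mod p).
Proof.
move=> sV na p pp; apply: sole_omits sV (na p pp); first exact: fic_same_count_mod.
exact: basic_AB.
Qed.

Lemma sole_omits_ZM V a : sole_atom a V -> ZM <> a ->
  omits (eqn V) (collapse eq (long 2)).
Proof. apply: sole_omits; [exact: fic_nilpotent|exact: basic_ZM]. Qed.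

Lemma sole_omits_SL V a : sole_atom a V -> SL <> a -> omits (eqn V) same_content.
Proof. apply: sole_omits; [exact: fic_same_content|exact: Or43]. Qed.

Lemma sole_omits_LZ V a : sole_atom a V -> LZ <> a -> omits (eqn V) same_head.
Proof. apply: sole_omits; [exact: fic_same_head|exact: Or41]. Qed.

Lemma sole_omits_RZ V a : sole_atom a V -> RZ <> a -> omits (eqn V) same_last.
Proof. apply: sole_omits; [exact: fic_same_last|exact: Or42]. Qed.

Lemma le_LZ V : sole_atom LZ V -> (V <= LZ)%O.
Proof.
move=> sV.
have neq b : ~ eqn b [:: 0; 1] [:: 0] -> b <> LZ by move=> H e; apply: H; rewrite e eqn_LZ.
apply/variety_leP => s t /eqn_LZ; apply: (omit_all_but_LZ (eqn_fic V)).
- apply: (sole_omits_AB sV) => p pp; apply: neq.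
  by rewrite eqn_AB => -[_ /(_ 1)]; rewrite /= prime_mod1 // mod0n.
- by apply: (sole_omits_ZM sV); apply: neq; rewrite eqn_ZM => -[|[]].
- by apply: (sole_omits_SL sV); apply: neq; rewrite eqn_SL => /(_ 1).
- by apply: (sole_omits_RZ sV); apply: neq; rewrite eqn_RZ.
Qed.

Lemma le_RZ V : sole_atom RZ V -> (V <= RZ)%O.
Proof.
move=> sV.
have neq b : ~ eqn b [:: 0; 1] [:: 1] -> b <> RZ by move=> H e; apply: H; rewrite e eqn_RZ.
apply/variety_leP => s t /eqn_RZ; apply: (omit_all_but_RZ (eqn_fic V)).
- apply: (sole_omits_AB sV) => p pp; apply: neq.
  by rewrite eqn_AB => -[_ /(_ 0)]; rewrite /= prime_mod1 // mod0n.
- by apply: (sole_omits_ZM sV); apply: neq; rewrite eqn_ZM => -[|[]].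
- by apply: (sole_omits_SL sV); apply: neq; rewrite eqn_SL => /(_ 0).
- by apply: (sole_omits_LZ sV); apply: neq; rewrite eqn_LZ.
Qed.

Lemma extensible_le_COM a : extensible_atom a -> (a <= COM)%O.
Proof.
case=> /atomP ba [X [aX sX]]; case: ba aX sX => [->|->|->|[->|[p pp ->]]] aX sX.
- by have := lt_le_trans aX (le_LZ sX); rewrite ltxx.
- by have := lt_le_trans aX (le_RZ sX); rewrite ltxx.
- by apply/variety_leP => s t /eqn_COM st; rewrite eqn_SL => x; rewrite (perm_mem st).
- apply/variety_leP => s t /eqn_COM st; rewrite eqn_ZM.
  have [s2|s2] := leqP 2 (size s); first by right; rewrite /long -(perm_size st).
  by left; apply: (perm_small_eq _ st); rewrite -(perm_size st).
- exact: AB_le_COM.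
Qed.

(** Letter counts that agree modulo a prime that exceeds both are equal. *)
Lemma COM_le_groups V : (forall p, prime p -> (AB p <= V)%O) -> (COM <= V)%O.
Proof.
move=> HV; apply/variety_leP => s t st; rewrite eqn_COM; apply/allP => x _ /=.
set i := count_mem x s; set j := count_mem x t.
have [p pij pp] := prime_above (i + j).
have := le_eqn (HV p pp) st; rewrite eqn_AB => -[_ /(_ x)].
by rewrite -/i -/j !modn_small ?(leq_ltn_trans _ pij) ?leq_addl ?leq_addr // => ->.
Qed.

Lemma lub_of_extensibleP c : lub_of_extensible c <-> c = COM.
Proof.
have lubCOM : lub_of_extensible COM.
  split; first exact: extensible_le_COM.
  by move=> x Hx; apply: COM_le_groups => p pp; apply/Hx/extensible_AB.
split=> [[ub least]|-> //]; apply: le_anti.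
by rewrite least ?lubCOM.2 //; exact: lubCOM.1.
Qed.

(** * Null semigroups among the commutative atoms *)

(** Where null semigroups are omitted, [x = x^(m+1)] holds, and every identity
    can be given long sides. *)
Lemma separable_ZM : separable ZM.
Proof.
move=> X Y YXZ; have [ZY|/negP nZY] := boolP (ZM <= Y)%O; [by left|right].
have ficY := eqn_fic Y.
have [m m0 Ym] := omit_ZM ficY (nle_omits (fic_nilpotent (ltn0Sn 1)) nZY).
pose h (x : nat) := nseq m.+1 x; have h0 x : h x != [::] by [].
have Yh s : eqn Y (subst h s) s.
  elim: s => [|x s IH]; first exact: (fic_refl ficY).
  rewrite subst_cons -[x :: s]/([:: x] ++ s); apply: (fic_cat ficY) IH.
  have := fic_subst ficY (f := fun=> [:: x]) (fun=> isT) Ym.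
  by rewrite subst_nseq rep_letter; apply: (fic_sym ficY).
have lh s : s != [::] -> long 2 (subst h s).
  case: s => // x s _; rewrite /long subst_cons size_cat size_nseq.
  by rewrite (leq_trans _ (leq_addr _ _)).
apply/variety_leP => s t st; have [s0|s0] := eqVneq s [::].
  by move: st; rewrite s0 => /(fic_nil (eqn_fic X)) ->; exact: (fic_refl ficY).
have t0 : t != [::] by rewrite -(sim_neq_nil (eqn_fic X) st).
apply: (fic_trans ficY (fic_sym ficY (Yh s))); apply: (fic_trans ficY _ (Yh t)).
apply: (le_eqn YXZ); apply/eqn_join; split; first exact: (fic_subst (eqn_fic X)).
by rewrite eqn_ZM; right; rewrite !lh.
Qed.

(** The theory of the commutative semigroups that satisfy [x^2 y = x y^2] and
    [x1 x2 x3 x4 = 0]. *)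
Definition equicontent4 : seq nat -> seq nat -> Prop :=
  collapse (fun s t => s =i t /\ size s = size t) (long 4).

Lemma fic_equicontent4 : fic equicontent4.
Proof.
have [_ lcl lcr ls] := ideal_long (ltn0Sn 3).
split=> [s|s t [[st e]|[ls' lt]]|t s u [[st e]|[ls' lt]] [[tu e']|[lt' lu]]
        |s [[st e]|[]//]|s t s' t' [[st e]|[ls' lt]] [[st' e']|[ls'' lt']]
        |f s t f0 [[st e]|[ls' lt]]].
- by left.
- by left; split.
- by right.
- by left; split=> [x|]; [rewrite st tu|rewrite e].
- by right; move: lt'; rewrite /long -e.
- by right; move: lt; rewrite /long e'.
- by right.
- by apply/size0nil; rewrite -e.
- by left; split=> [x|]; [rewrite !mem_cat st st'|rewrite !size_cat e e'].
- by right; split; apply: lcr.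
- by right; split; apply: lcl.
- by right; split; apply: lcl.
- (* Words of length at most 2 with the same content and length are
     permutations of each other. Words of length 3 keep it unless some letter
     gets a longer image, and this makes both sides zero. *)
  have fst : subst f s =i subst f t by move=> y; rewrite !mem_subst; apply: eq_has_r.
  have [e3|ne3] := eqVneq (size s) 3; last first.
    have [s4|s4] := leqP 4 (size s); first by right; split; apply: ls => //; rewrite /long -e.
    left; split=> //; apply: perm_size; apply: (fic_subst fic_perm) => //.
    case: s st e ne3 s4 {fst} => [|a [|b [|c [|? ?]]]] //.
    + by case: t.
    + by case: t => [|a' []] //= st _ _ _; have := st a; rewrite !inE eqxx => /esym/eqP ->.
    + case: t => [|a' [|b' []]] //= st _ _ _.
      have [ab|ab] := eqVneq a b.
        have := st a'; have := st b'; rewrite ab !inE !eqxx !orbb orbT.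
        by do 2!move=> /eqP ->.
      have Us : uniq [:: a; b] by rewrite /= inE ab.
      by apply: uniq_perm => //; apply: (leq_size_uniq Us) => // x; rewrite st.
  have [u|] := boolP (all (fun x => size (f x) == 1) s).
    left; split=> //.
    have size1 r : all (fun x => size (f x) == 1) r -> size (subst f r) = size r.
      by elim: r => // x r IH /= /andP[/eqP fx /IH]; rewrite subst_cons size_cat fx => ->.
    by rewrite !size1 // -(eq_all_r st).
  case/allPn => x xs fx1; right.
  have big r : x \in r -> size r < size (subst f r).
    case/splitPr => r1 r2; rewrite subst_cat subst_cons !size_cat /=.
    have := leq_size_subst r1 f0; have := leq_size_subst r2 f0.
    have : 1 < @size nat (f x) by rewrite ltn_neqAle eq_sym fx1 lt0n size_eq0 f0.
    by lia.
  by rewrite /long; move: (big s xs) (big t); rewrite -e e3 -st => -> /(_ xs) ->.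
- by right; split; apply: ls.
Qed.

Lemma fic_and E F : fic E -> fic F -> fic (fun s t => E s t /\ F s t).
Proof.
move=> fE fF; split=> [s|s t []|t s u [a b] [c d]|s [a _]|s t s' t' [a b] [c d]|f s t f0 [a b]].
- by split; [exact: (fic_refl fE)|exact: (fic_refl fF)].
- by split; [exact: (fic_sym fE)|exact: (fic_sym fF)].
- by split; [exact: (fic_trans fE) a c|exact: (fic_trans fF) b d].
- exact: (fic_nil fE).
- by split; [exact: (fic_cat fE)|exact: (fic_cat fF)].
- by split; [exact: (fic_subst fE)|exact: (fic_subst fF)].
Qed.

(** Let [X] be the nil variety with theory [equicontent4]. Its identity
    [x^2 y = x y^2] is violated by the groups of order [p], so it is lost in
    [X \/ AB p]. The nil semigroups with [x1 x2 x3 x4 = 0] in this join form a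
    variety that omits [AB p] and still violates it. *)
Lemma not_separable_AB p : prime p -> ~ separable (AB p).
Proof.
move=> pp sep; pose F s t := equicontent4 s t /\ same_count_mod p s t.
have ficF : fic F by exact: fic_and fic_equicontent4 (fic_same_count_mod p).
have ficY : fic (collapse F (long 4)).
  apply: fic_collapse ficF (ideal_long _) _ => // s t [[[_ e]|[]//] _].
  by rewrite /long e.
case: (sep (var_of equicontent4) (var_of (collapse F (long 4)))).
- apply/variety_leP => s t /eqn_join[/(eqn_var_of fic_equicontent4) Est /eqn_AB Ast].
  by apply/eqn_var_of => //; left.
- have E : eqn (var_of (collapse F (long 4))) (nseq 4 0) (nseq 5 0).
    by apply/eqn_var_of => //; right.
  move=> /le_eqn/(_ E)/eqn_AB[_ /(_ 0)] /= /eqP.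
  by rewrite eq_sym eqn_mod_dvd // dvdn1 => /eqP e; rewrite e in pp.
- have E : eqn (var_of equicontent4) [:: 0; 0; 1] [:: 0; 1; 1].
    apply/(eqn_var_of fic_equicontent4); left; split=> // x.
    by rewrite !inE; case: (x == 0); case: (x == 1).
  move=> /le_eqn/(_ E)/(eqn_var_of ficY)[[_ [_ /(_ 0)]]|[]//] /= /eqP.
  by rewrite eqn_mod_dvd // dvdn1 => /eqP e; rewrite e in pp.
Qed.

(** A commutative variety with semilattices as sole atom omits null semigroups,
    so it consists of bands. *)
Lemma sole_SL V : (V <= COM)%O -> sole_atom SL V -> (V <= SL)%O.
Proof.
move=> VC sV; have neq b : ~ eqn b [:: 0; 0] [:: 0] -> b <> SL.
  by move=> H e; apply: H; rewrite e eqn_SL => x; rewrite !inE orbb.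
apply/variety_leP => s t /eqn_SL; apply: (commutative_band (eqn_fic V)).
- apply: (omit_ZM_band (eqn_fic V)).
    apply: (sole_omits_AB sV) => p pp; apply: neq; rewrite eqn_AB => -[_ /(_ 0)] /= /eqP.
    by rewrite eqn_mod_dvd // dvdn1 => /eqP e; rewrite e in pp.
  by apply: (sole_omits_ZM sV); apply: neq; rewrite eqn_ZM => -[|[]].
- by move=> u v uv; apply: (le_eqn VC); apply/eqn_COM.
Qed.

Lemma characterize_ZM z X : is_atom z -> separable z -> sole_atom z X ->
  (z < X)%O -> (X <= COM)%O -> z = ZM.
Proof.
move=> /atomP bz sepz sX zX XC; have zC := le_trans (ltW zX) XC.
case: bz sepz sX zX zC => [->|->|->|[-> //|[p pp ->]]] sepz sX zX zC.
- by case: (LZ_nle_COM zC).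
- by case: (RZ_nle_COM zC).
- by have := lt_le_trans zX (sole_SL XC sX); rewrite ltxx.
- by case: (not_separable_AB pp sepz).
Qed.

(** * Nilpotent varieties *)

Lemma sole_ZM_NIL n : 0 < n -> sole_atom ZM (NIL n).
Proof.
move=> n0 b /atomP bb le.
have E : eqn (NIL n) (nseq n 0) (nseq n 1).
  by rewrite eqn_NIL //; right; rewrite /long !size_nseq.
have F : eqn (NIL n) (nseq n 0) (nseq n.+1 0).
  by rewrite eqn_NIL //; right; rewrite /long !size_nseq.
case: bb le => [->|->|->|[//|[p pp ->]]] le.
- by have := le_eqn le E; rewrite eqn_LZ /same_head; case: (n) n0.
- by have := le_eqn le E; rewrite eqn_RZ /same_last !rev_nseq; case: (n) n0.
- by have := le_eqn le E; rewrite eqn_SL => /(_ 0); case: (n) n0 => // m _; rewrite !mem_nseq.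
- have := le_eqn le F; rewrite eqn_AB => -[_ /(_ 0)] /eqP.
  rewrite !count_nseq /= eq_sym eqn_mod_dvd ?mul1n // subSnn dvdn1 => /eqP e.
  by rewrite e in pp.
Qed.

Lemma sole_ZM_nil V : sole_atom ZM V -> exists a, nil_exponent (eqn V) a.
Proof.
move=> sV; have neq b : ~ eqn b [:: 0; 0] [:: 1; 1; 1] -> b <> ZM.
  by move=> H e; apply: H; rewrite e eqn_ZM; right.
apply: (omit_all_but_ZM (eqn_fic V)).
- apply: (sole_omits_AB sV) => p pp e; have : eqn ZM [:: 0; 0] [:: 0; 0; 0].
    by rewrite eqn_ZM; right.
  rewrite -e eqn_AB => -[_ /(_ 0)] /= /eqP.
  by rewrite eq_sym eqn_mod_dvd // dvdn1 => /eqP q; rewrite q in pp.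
- by apply: (sole_omits_SL sV); apply: neq; rewrite eqn_SL => /(_ 0).
- by apply: (sole_omits_LZ sV); apply: neq; rewrite eqn_LZ.
- by apply: (sole_omits_RZ sV); apply: neq; rewrite eqn_RZ.
Qed.

Lemma le_NIL V n : 0 < n -> (forall s t, long n s -> long n t -> eqn V s t) -> (V <= NIL n)%O.
Proof.
move=> n0 H; apply/variety_leP => s t; rewrite eqn_NIL // => -[->|[ls lt]]; last exact: H.
exact: (fic_refl (eqn_fic V)).
Qed.

Lemma nil_sub V W a : (W <= V)%O -> nil_exponent (eqn V) a -> nil_exponent (eqn W) a.
Proof.
by move=> WV [a0 zz zl zr]; split=> // u v u0; [move=> v0| |];
  apply: (le_eqn WV); [exact: zz|exact: zl|exact: zr].
Qed.

(** A proper subvariety of [CLIN] is nilpotent of some class [n], hence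
    strictly below the proper subvariety [CLIN_NIL n.+1]. *)
Lemma above_CLIN_not_lower_covered V a : nil_exponent (eqn V) a -> (CLIN <= V)%O -> ~ lower_covered V.
Proof.
move=> nilV CV covV.
have ltC : (AB 1 < CLIN)%O.
  rewrite lt_leAnge trivial_le; apply/negP => le.
  have : eqn CLIN [:: 0] [:: 1] by apply: (le_eqn le); apply/eqn_trivial.
  by rewrite eqn_CLIN => -[|[]].
have [Y [YC Ymax]] := covV _ _ CV ltC.
have nilY := nil_sub (le_trans (ltW YC) CV) nilV.
have [n n0 Yn] : exists2 n, 0 < n & forall s t, long n s -> long n t -> eqn Y s t.
  apply: (nil_nilpotent (eqn_fic Y) nilY); apply: nle_omits.
    by apply: fic_perm_collapse; [exact: ideal_nonlinear|exact: perm_nonlinear].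
  by move=> CY; have := le_lt_trans CY YC; rewrite ltxx.
have nonlin k : nonlinear (nseq k.+2 0) by [].
have YZ : (Y <= CLIN_NIL n.+1)%O.
  apply/variety_leP => s t; rewrite eqn_CLIN_NIL // => -[st|[Is It]].
    by apply: (le_eqn (ltW YC)); rewrite eqn_CLIN; left.
  suff H r : nonlinear_or_long n.+1 r -> eqn Y r (nseq n.+2 0).
    exact: (fic_trans (eqn_fic Y) (H _ Is) (fic_sym (eqn_fic Y) (H _ It))).
  case/orP => [nr|lr]; first by apply: (le_eqn (ltW YC)); rewrite eqn_CLIN; right.
  by apply: Yn; [exact: ltnW|rewrite /long size_nseq; lia].
have ZC : (CLIN_NIL n.+1 < CLIN)%O.
  rewrite lt_leAnge; apply/andP; split; last apply/negP => CZ.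
    apply/variety_leP => s t; rewrite eqn_CLIN eqn_CLIN_NIL //.
    by case=> [st|[ns nt]]; [left|right; rewrite /nonlinear_or_long ns nt].
  have : eqn (CLIN_NIL n.+1) (iota 0 n.+1) (nseq n.+2 0).
    rewrite eqn_CLIN_NIL //; right; split; apply/orP; last by left.
    by right; rewrite /long size_iota.
  move=> /(le_eqn CZ)/eqn_CLIN[/perm_size|[]]; last by rewrite /nonlinear iota_uniq.
  by rewrite size_iota size_nseq; lia.
have /le_eqn/(_ (Yn (iota 0 n) (nseq n.+1 0) _ _)) := Ymax _ YZ ZC.
rewrite /long size_iota size_nseq leqnn leqnSn => /(_ isT isT).
rewrite eqn_CLIN_NIL // => -[/perm_size|[]].
  by rewrite size_iota size_nseq; lia.
by rewrite /nonlinear_or_long /nonlinear /long iota_uniq size_iota ltnn.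
Qed.

Lemma sole_ZM_nilpotent N : sole_atom ZM N -> lower_covered N ->
  exists2 n, 0 < n & (N <= NIL n)%O.
Proof.
move=> sN cN; have [a nilN] := sole_ZM_nil sN.
have [|n n0 Nn] := nil_nilpotent (eqn_fic N) nilN; last by exists n => //; apply: le_NIL.
apply: nle_omits; last by move=> CN; exact: (above_CLIN_not_lower_covered nilN CN).
by apply: fic_perm_collapse; [exact: ideal_nonlinear|exact: perm_nonlinear].
Qed.

(** Up to renaming, the identities of a subvariety of [NIL n] follow from
    those between words of length at most [n] in [2n] letters, which are
    finitely many. *)
Lemma lower_covered_NIL n : 0 < n -> lower_covered (NIL n).
Proof.
move=> n0 X W XN WX; pose T : finType := {bseq n of 'I_(n + n).+1}.
pose dec (b : T) := map (@nat_of_ord (n + n).+1) b.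
pose ids (Y : variety) := [set p : T * T | `[< eqn Y (dec p.1) (dec p.2) >]]%SET.
have reduce (Y Z : variety) : (Y <= NIL n)%O -> (Z <= NIL n)%O ->
    ids Y \subset ids Z -> (Z <= Y)%O.
  move=> YN ZN /fintype.subsetP YZ; apply/variety_leP => s t st.
  have cut (V : variety) r : (V <= NIL n)%O -> eqn V r (take n r).
    move=> VN; apply: (le_eqn VN); rewrite eqn_NIL //.
    have [lr|lr] := leqP n (size r); last by left; rewrite take_oversize // ltnW.
    by right; rewrite /long size_takel.
  have ficY := eqn_fic Y; have ficZ := eqn_fic Z.
  have {}st : eqn Y (take n s) (take n t).
    exact: (fic_trans ficY (fic_sym ficY (cut _ _ YN)) (fic_trans ficY st (cut _ _ YN))).
  suff stZ : eqn Z (take n s) (take n t).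
    exact: (fic_trans ficZ (cut _ _ ZN) (fic_trans ficZ stZ (fic_sym ficZ (cut _ _ ZN)))).
  set r := take n s ++ take n t; pose code x := index x r; pose decode i := nth 0 r i.
  have size_r : size r <= n + n by rewrite size_cat leq_add // size_take_min geq_minl.
  have encode q : size q <= n -> exists b : T, dec b = map code q.
    move=> qn; have Hsz : size (map (fun x => inord (code x) : 'I_(n + n).+1) q) <= n.
      by rewrite size_map.
    exists (Bseq Hsz); rewrite /dec /= -map_comp; apply: eq_map => x /=.
    by rewrite inordK // ltnS (leq_trans (index_size _ _)).
  have codeK q : {subset q <= r} -> map decode (map code q) = q.
    by move=> qr; rewrite -map_comp; apply: map_id_in => x /qr xr; rewrite /decode /= nth_index.
  have [|b bs] := encode (take n s); first by rewrite size_take_min geq_minl.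
  have [|c ct] := encode (take n t); first by rewrite size_take_min geq_minl.
  have : (b, c) \in ids Y.
    rewrite inE /= bs ct; apply/asboolP; rewrite -!subst_letters.
    exact: (fic_subst ficY).
  move/YZ; rewrite inE /= bs ct => /asboolP st'.
  have := fic_subst ficZ (f := fun i => [:: decode i]) (fun=> isT) st'.
  by rewrite !subst_letters !codeK // => x xs; rewrite mem_cat xs ?orbT.
have ids_le (Y Z : variety) : (Y <= Z)%O -> ids Z \subset ids Y.
  move=> YZ; apply/fintype.subsetP => p; rewrite !inE => pZ.
  exact: (le_eqn YZ pZ).
pose P k := `[< exists2 Y : variety, (Y < X)%O & #|ids Y| = k >].
have exP : exists k, P k by exists #|ids W|; apply/asboolP; exists W.
case: (ex_minnP exP) => k /asboolP[Y YX <-] kmin; exists Y; split=> // Z YZ ZX.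
have ZN := le_trans (ltW ZX) XN; have YN := le_trans (ltW YX) XN.
apply: reduce => //; have /eqP -> : ids Z == ids Y; last by [].
by rewrite eqEcard ids_le //=; apply: kmin; apply/asboolP; exists Z.
Qed.

(** * Bounding strongly permutative varieties *)

Definition perm_seq n (s : 'S_n.+1) : seq nat := [seq nat_of_ord (s i) | i <- enum 'I_n.+1].

Lemma perm_seqE n (s : 'S_n.+1) : perm_seq s = (perm_word s).1 :: (perm_word s).2.
Proof. by rewrite /perm_seq enum_ordSl /= -map_comp. Qed.

Lemma perm_seq_uniq n (s : 'S_n.+1) : uniq (perm_seq s).
Proof. by rewrite map_inj_uniq ?enum_uniq // => i j /val_inj/perm_inj. Qed.

Lemma perm_seq_eq n (s t : 'S_n.+1) : perm_eq (perm_seq s) (perm_seq t).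
Proof.
apply: uniq_perm; rewrite ?perm_seq_uniq // => x.
suff sub (r r' : 'S_n.+1) : x \in perm_seq r -> x \in perm_seq r' by apply/idP/idP; apply: sub.
case/mapP => i _ ->; apply/mapP; exists ((r'^-1)%g (r i)); rewrite ?mem_enum //.
by rewrite permKV.
Qed.

Lemma perm_seq_head n (s : 'S_n.+1) : ohead (perm_seq s) = Some (nat_of_ord (s ord0)).
Proof. by rewrite perm_seqE. Qed.

Lemma perm_seq_last n (s : 'S_n.+1) :
  ohead (rev (perm_seq s)) = Some (nat_of_ord (s ord_max)).
Proof. by rewrite /perm_seq enum_ordSr map_rcons rev_rcons. Qed.

Lemma size_perm_seq n (s : 'S_n.+1) : size (perm_seq s) = n.+1.
Proof. by rewrite size_map size_enum_ord. Qed.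

Lemma identities_perm (V : variety) n (s t : 'S_n.+1) :
  identities V (perm_word s, perm_word t) <-> eqn V (perm_seq s) (perm_seq t).
Proof.
rewrite !perm_seqE eqn_identities.
by rewrite -!surjective_pairing.
Qed.

Lemma strongly_permutativeP (V : variety) :
  strongly_permutative V <-> exists2 n, 0 < n & (V <= COM `|` NIL n)%O.
Proof.
split=> [[n [s [_ s0 sn /identities_perm VE]]]|[n n0 VC]].
  have [M HM] : exists M, forall u v, perm_eq u v -> M <= size u -> eqn V u v.
    apply: (long_balanced (eqn_fic V) _ _ VE); rewrite ?perm_seq_uniq ?perm_seq_eq //.
      by rewrite !perm_seq_head perm1 => -[e]; case/eqP: s0; apply: val_inj; exact: (esym e).
    by rewrite !perm_seq_last perm1 => -[e]; case/eqP: sn; apply: val_inj; exact: (esym e).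
  exists M.+1 => //; apply/variety_leP => u v /eqn_join[].
  rewrite eqn_COM eqn_NIL // => uv [->|[lu _]]; first exact: (fic_refl (eqn_fic V)).
  exact/HM/ltnW.
(* The reversal of the letters moves both the first and the last one. *)
pose s := perm (can_inj (@rev_ordK n.+1)); exists n, s.
have s0 : s ord0 != ord0 by rewrite permE -val_eqE /= subn1 -lt0n.
have sn : s ord_max != ord_max by rewrite permE -val_eqE /= subnn eq_sym -lt0n.
split=> //; first by apply: contra s0 => /eqP ->; rewrite perm1.
apply/identities_perm/(le_eqn VC)/eqn_join; split; first exact/eqn_COM/perm_seq_eq.
by rewrite eqn_NIL //; right; rewrite /long !size_perm_seq leqnSn.
Qed.

(** * The formula *)

(** What the formula says: [c] must be [COM], [z] must be [ZM], and [n] must be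
    nilpotent. The element [x] rules out the semilattices and the left and right
    zero semigroups as values of [z]. *)
Definition permutative_bound (V : variety) : Prop :=
  exists c, lub_of_extensible c /\ exists z, is_atom z /\ separable z /\
  exists n, sole_atom z n /\ lower_covered n /\
    (exists x, (z < x)%O /\ (x <= n)%O /\ (x <= c)%O) /\ (V <= c `|` n)%O.

Lemma CNIL_le_NIL m n : 0 < m -> m <= n -> (CNIL m <= NIL n)%O.
Proof.
move=> m0 mn; have n0 := leq_trans m0 mn; apply/variety_leP => s t.
rewrite eqn_NIL // eqn_CNIL // => -[->|[ls lt]]; first by left; apply: perm_refl.
by right; rewrite /long !(leq_trans mn).
Qed.

Lemma permutative_boundP V : strongly_permutative V <-> permutative_bound V.
Proof.
rewrite strongly_permutativeP; split=> [[n n0 VN]|].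
  exists COM; split; first exact/lub_of_extensibleP.
  exists ZM; split; first exact/atomP/basic_ZM.
  split; first exact: separable_ZM.
  (* NIL n itself may be too small: the commutative semigroups with xyz = 0
     must be below it. *)
  have m0 : 0 < maxn 3 n by rewrite leq_max.
  exists (NIL (maxn 3 n)); split; first exact: sole_ZM_NIL.
  split; first exact: lower_covered_NIL.
  split; last first.
    apply: (le_trans VN); rewrite leU2 //; apply: le_NIL => // s t ls lt.
    by rewrite eqn_NIL //; right; rewrite /long !(leq_trans (leq_maxr 3 n)).
  exists (CNIL 3); split; last split; last first.
  - by apply/variety_leP => s t /eqn_COM st; rewrite eqn_CNIL //; left.
  - by rewrite CNIL_le_NIL // leq_maxl.
  - rewrite lt_leAnge; apply/andP; split; last apply/negP => le.
      apply/variety_leP => s t; rewrite eqn_CNIL // eqn_ZM.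
      have [s2|s2] := leqP 2 (size s).
        case=> [/perm_size e|[_ t3]]; right; rewrite /long s2 -?e ?s2 //.
        by split=> //; apply: ltnW.
      case=> [st|[]]; last by rewrite /long; lia.
      by left; apply: (perm_small_eq _ st); rewrite -(perm_size st).
    have : eqn ZM [:: 0; 0] [:: 1; 1] by rewrite eqn_ZM; right.
    by move=> /(le_eqn le); rewrite eqn_CNIL // => -[|[]].
case=> c [/lub_of_extensibleP -> [z [az [sz [N [sN [cN [[X [zX [XN XC]]] VN]]]]]]]].
have zZM : z = ZM.
  by apply: (characterize_ZM az sz _ zX XC) => b ab bX; apply: sN => //; apply: le_trans XN.
rewrite zZM in sN; have [n n0 Nn] := sole_ZM_nilpotent sN cN.
by exists n => //; apply: (le_trans VN); rewrite leU2.
Qed.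

Section Formulas.
Context {d : Order.disp_t} {L : latticeType d}.
Implicit Type e : nat -> L.

Definition le_formula i j := LEq (LJoin (LVar i) (LVar j)) (LVar j).
Definition lt_formula i j := LAnd (le_formula i j) (LNot (LEq (LVar i) (LVar j))).

(** Bound variables are named [k], [k+1], ... for a [k] above the free ones. *)
Definition atom_formula i k :=
  LAnd (LExists k (lt_formula k i))
    (LForall k (LImplies (lt_formula k i) (LForall k.+1 (le_formula k k.+1)))).

Definition sole_atom_formula i j k :=
  LForall k (LImplies (atom_formula k k.+1) (LImplies (le_formula k j) (LEq (LVar k) (LVar i)))).

Definition extensible_formula i k :=
  LAnd (atom_formula i k)
    (LExists k (LAnd (lt_formula i k) (sole_atom_formula i k k.+1))).

Definition lub_formula i k :=
  LAnd (LForall k (LImplies (extensible_formula k k.+1) (le_formula k i)))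
    (LForall k (LImplies
      (LForall k.+1 (LImplies (extensible_formula k.+1 k.+2) (le_formula k.+1 k)))
      (le_formula i k))).

Definition separable_formula i k :=
  LForall k (LForall k.+1 (LImplies
    (LEq (LJoin (LVar k.+1) (LJoin (LVar k) (LVar i))) (LJoin (LVar k) (LVar i)))
    (LOr (le_formula i k.+1) (le_formula k.+1 k)))).

Definition lower_covered_formula i k :=
  LForall k (LForall k.+1 (LImplies (le_formula k i) (LImplies (lt_formula k.+1 k)
    (LExists k.+2 (LAnd (lt_formula k.+2 k)
      (LForall k.+3 (LImplies (le_formula k.+2 k.+3)
        (LImplies (lt_formula k.+3 k) (le_formula k.+3 k.+2))))))))).

Lemma le_formulaE e i j : lholds e (le_formula i j) = (e i <= e j)%O.
Proof. by rewrite /= leEjoin; apply/propext; split=> /eqP. Qed.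

Lemma lt_formulaE e i j : lholds e (lt_formula i j) = (e i < e j)%O.
Proof.
rewrite -[LHS]/(lholds e (le_formula i j) /\ ~ e i = e j) le_formulaE lt_neqAle.
by apply/propext; split=> [[-> /eqP ->]//|/andP[/eqP ne ->]].
Qed.

Lemma lholds_and e f g : lholds e (LAnd f g) = (lholds e f /\ lholds e g).
Proof. by []. Qed.
Lemma lholds_or e f g : lholds e (LOr f g) = (lholds e f \/ lholds e g).
Proof. by []. Qed.
Lemma lholds_implies e f g : lholds e (LImplies f g) = (lholds e f -> lholds e g).
Proof. by []. Qed.
Lemma lholds_forall e k f :
  lholds e (LForall k f) = forall a : L, lholds [eta e with k |-> a] f.
Proof. by []. Qed.
Lemma lholds_exists e k f :
  lholds e (LExists k f) = exists a : L, lholds [eta e with k |-> a] f.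
Proof. by []. Qed.
(** The rules for inequalities come first, as the rules for connectives also
    match these formulas up to unfolding. *)
Definition lholdsE := (le_formulaE, lt_formulaE, lholds_implies, lholds_or, lholds_and).

Ltac eval_variables := rewrite /=; repeat match goal with
  | |- context [?a == ?b] =>
    first [replace (a == b) with true by lia | replace (a == b) with false by lia]
  end.

Lemma atom_formulaE e i k : i < k -> lholds e (atom_formula i k) = is_atom (e i).
Proof.
move=> ik; rewrite /atom_formula lholdsE lholds_exists lholds_forall; congr (_ /\ _).
  by apply: eq_exists => b; rewrite lholdsE; eval_variables.
apply: eq_forall => b; rewrite !lholdsE lholds_forall.
by congr (_ -> _); [|apply: eq_forall => c; rewrite lholdsE]; eval_variables.
Qed.

Lemma sole_atom_formulaE e i j k : i < k -> j < k ->
  lholds e (sole_atom_formula i j k) = sole_atom (e i) (e j).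
Proof.
move=> ik jk; rewrite /sole_atom_formula lholds_forall; apply: eq_forall => b.
by rewrite !lholds_implies atom_formulaE // le_formulaE; eval_variables.
Qed.

Lemma extensible_formulaE e i k : i < k ->
  lholds e (extensible_formula i k) = extensible_atom (e i).
Proof.
move=> ik; rewrite /extensible_formula lholds_and lholds_exists atom_formulaE //.
congr (_ /\ _); apply: eq_exists => x.
by rewrite lholds_and lt_formulaE sole_atom_formulaE ?(leqW ik) //; eval_variables.
Qed.

Lemma lub_formulaE e i k : i < k -> lholds e (lub_formula i k) = lub_of_extensible (e i).
Proof.
move=> ik; rewrite /lub_formula lholds_and !lholds_forall; congr (_ /\ _).
  apply: eq_forall => a.
  by rewrite lholds_implies extensible_formulaE // le_formulaE; eval_variables.
apply: eq_forall => x; rewrite lholds_implies le_formulaE lholds_forall.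
congr (_ -> _); last by eval_variables.
by apply: eq_forall => a; rewrite lholds_implies extensible_formulaE // le_formulaE; eval_variables.
Qed.

Lemma separable_formulaE e i k : i < k ->
  lholds e (separable_formula i k) = separable (e i).
Proof.
move=> ik; rewrite /separable_formula lholds_forall; apply: eq_forall => x.
rewrite lholds_forall; apply: eq_forall => y; rewrite !lholdsE; eval_variables.
by congr (_ -> _); rewrite leEjoin; apply/propext; split=> /eqP.
Qed.

Lemma lower_covered_formulaE e i k : i < k ->
  lholds e (lower_covered_formula i k) = lower_covered (e i).
Proof.
move=> ik; rewrite /lower_covered_formula lholds_forall; apply: eq_forall => x.
rewrite lholds_forall; apply: eq_forall => w; rewrite !lholdsE lholds_exists.
congr (_ -> _ -> _); [by eval_variables|by eval_variables|apply: eq_exists => y].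
rewrite !lholdsE lholds_forall; congr (_ /\ _); first by eval_variables.
by apply: eq_forall => z; rewrite !lholdsE; eval_variables.
Qed.

End Formulas.

(** The variables 1, 2, 3, 4 are the [c], [z], [n], [x] of [permutative_bound]. *)
Definition strongly_permutative_formula : lformula :=
  LExists 1 (LAnd (lub_formula 1 5)
    (LExists 2 (LAnd (atom_formula 2 5) (LAnd (separable_formula 2 5)
      (LExists 3 (LAnd (sole_atom_formula 2 3 5) (LAnd (lower_covered_formula 3 5)
        (LAnd (LExists 4 (LAnd (lt_formula 2 4) (LAnd (le_formula 4 3) (le_formula 4 1))))
          (LEq (LJoin (LVar 0) (LJoin (LVar 1) (LVar 3))) (LJoin (LVar 1) (LVar 3))))))))))).

Lemma strongly_permutative_formulaE (e : nat -> SEM) :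
  lholds e strongly_permutative_formula = permutative_bound (e 0).
Proof.
rewrite /strongly_permutative_formula lholds_exists; apply: eq_exists => c.
rewrite lholds_and lub_formulaE // lholds_exists; congr (_ /\ _); apply: eq_exists => z.
rewrite 2!lholds_and atom_formulaE // separable_formulaE // lholds_exists.
do 2!congr (_ /\ _); apply: eq_exists => n.
rewrite 3!lholds_and sole_atom_formulaE // lower_covered_formulaE // lholds_exists.
do 2!congr (_ /\ _); congr (_ /\ _); last by rewrite leEjoin; apply/propext; split=> /eqP.
by apply: eq_exists => x; rewrite !lholdsE.
Qed.

Theorem theorem6p3 : definable (strongly_permutative : set SEM).
Proof.
exists strongly_permutative_formula, 0; split=> [x|e].
  by rewrite !inE /=; case: (x == 0).
by rewrite strongly_permutative_formulaE; apply: iff_sym; apply: permutative_boundP.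
Qed.
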